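(* Let $G=SU(2,2)$, $K=S(U(2)\times U(2))$, and let $\Lambda=(\Lambda_1,\Lambda_2,\Lambda_3,\Lambda_4)\in\mathcal C_{\mathrm{hol}}$. Then $\Delta_K(G\cdot\Lambda)$ is the set of $\xi=(\xi_1,\xi_2,\xi_3,\xi_4)\in\mathfrak t^*$ satisfying $$\left\{\begin{aligned}&\xi_1\ge\Lambda_1,\quad\xi_2\ge\Lambda_2,\quad\xi_3\le\Lambda_3,\quad\xi_4\le\Lambda_4,\\&|\xi_1-\xi_2-\xi_3+\xi_4|\le\Lambda_1-\Lambda_2+\Lambda_3-\Lambda_4,\\&-\xi_1+\xi_2-\xi_3+\xi_4\le-|\Lambda_1-\Lambda_2-\Lambda_3+\Lambda_4|,\\&\xi_1\ge\xi_2,\quad\xi_3\ge\xi_4.\end{aligned}\right.$$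
   Context: $T$ is the maximal torus of diagonal matrices in $SU(2,2)$, with Lie algebra $\mathfrak t=\{i\,\mathrm{diag}(h_1,h_2,h_3,h_4):h_j\in\mathbb R,\ \sum h_j=0\}$, and $e_j^*(i\,\mathrm{diag}(h_1,\dots,h_4))=h_j$. Elements $\xi\in\mathfrak t^*$ are written $\xi=(\xi_1,\dots,\xi_4)$, meaning $\xi=\sum_j\xi_je_j^*$ with the normalization $\sum_j\xi_j=0$. Roots $\alpha\in\mathfrak t^*$ are defined by $[H,X]=i\alpha(H)X$, $H\in\mathfrak t$; with $\alpha_{i,j}=e_i^*-e_j^*$, the positive compact roots are $\alpha_{1,2},\alpha_{3,4}$, so $\mathfrak t_+^*=\{\xi_1\ge\xi_2,\ \xi_3\ge\xi_4\}$, and the positive noncompact roots (for the chosen invariant complex structure on $G/K$) are $\mathfrak R_n^+=\{\alpha_{i,j}:1\le i\le2,\ 3\le j\le4\}$. The holomorphic chamber is $\mathcal C_{\mathrm{hol}}=\{\xi\in\mathfrak t_+^*:(\beta,\xi)>0\ \forall\beta\in\mathfrak R_n^+\}=\{\xi_1\ge\xi_2>\xi_3\ge\xi_4\}$. As usual $\mathfrak t^*\subset\mathfrak k^*\subset\mathfrak g^*$ via the Killing form. $G\cdot\Lambda$ is the coadjoint orbit, $\Phi_K:G\cdot\Lambda\to\mathfrak k^*$ is the restriction of the projection $\mathfrak g^*\to\mathfrak k^*$, and $\Delta_K(G\cdot\Lambda)=\Phi_K(G\cdot\Lambda)\cap\mathfrak t_+^*$. *)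

(* Defs.v *)
From HB Require Import structures.
From mathcomp Require Import all_boot all_order all_algebra.
From mathcomp Require Import classical_sets reals.
From mathcomp Require Import complex.

Set Implicit Arguments.
Unset Strict Implicit.
Unset Printing Implicit Defensive.

Import Order.TTheory GRing.Theory Num.Theory.

Local Open Scope ring_scope.
Local Open Scope sesquilinear_scope.
Local Open Scope classical_set_scope.

(* Complex 4 x 4 matrices, seen as a vector space over the reals (of dimension
   32).  The alias keeps this structure apart from the canonical R[i]-module
   structure on 'M[R[i]]_4. *)
Definition rmat (R : realType) : Type := 'M[R[i]]_4.

Section RealMatrices.
Variable R : realType.

HB.instance Definition _ := GRing.Zmodule.copy (rmat R) 'M[R[i]]_4.

Definition rmat_scale (a : R) (X : rmat R) : rmat R :=
  map_mx ( *%R a%:C%C ) (X : 'M[R[i]]_4).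

Fact rmat_scaleA a b X :
  rmat_scale a (rmat_scale b X) = rmat_scale (a * b) X.
Proof. by apply/matrixP => i j; rewrite !mxE mulrA rmorphM. Qed.

Fact rmat_scale1 : left_id 1 rmat_scale.
Proof. by move=> X; apply/matrixP => i j; rewrite !mxE rmorph1 mul1r. Qed.

Fact rmat_scaleDr : right_distributive rmat_scale +%R.
Proof. by move=> a X Y; apply/matrixP => i j; rewrite !mxE mulrDr. Qed.

Fact rmat_scaleDl X : {morph rmat_scale^~ X : a b / a + b}.
Proof. by move=> a b; apply/matrixP => i j; rewrite !mxE rmorphD mulrDl. Qed.

HB.instance Definition _ := GRing.Zmodule_isLmodule.Build R (rmat R)
  rmat_scaleA rmat_scale1 rmat_scaleDr rmat_scaleDl.

Lemma rmat_scaleE a (X : rmat R) :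
  a *: X = a%:C%C *: (X : 'M[R[i]]_4) :> 'M[R[i]]_4.
Proof. by apply/matrixP => i j; rewrite !mxE. Qed.

Fact rmat_vect_axiom : Vector.axiom (4 * 4 + 4 * 4) (rmat R).
Proof.
pose toR (X : rmat R) : 'rV[R]_(4 * 4 + 4 * 4) :=
  row_mx (mxvec (map_mx (@complex.Re R) (X : 'M[R[i]]_4)))
         (mxvec (map_mx (@complex.Im R) (X : 'M[R[i]]_4))).
pose ofR (v : 'rV[R]_(4 * 4 + 4 * 4)) : rmat R :=
  \matrix_(i, j) (vec_mx (lsubmx v) i j +i* vec_mx (rsubmx v) i j)%C.
exists toR.
- move=> a X Y; rewrite /toR scale_row_mx add_row_mx -!linearP /=.
  by congr (row_mx (mxvec _) (mxvec _)); apply/matrixP => i j;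
     rewrite !mxE; case: (X i j) => ? ?; case: (Y i j) => ? ? /=;
     rewrite mul0r ?subr0 ?addr0.
- exists ofR => [X|v].
    apply/matrixP => i j.
    by rewrite mxE /toR row_mxKl row_mxKr !mxvecK !mxE; case: (X i j).
  rewrite -[RHS]hsubmxK /toR; congr row_mx; rewrite -[RHS]vec_mxK;
    by congr mxvec; apply/matrixP => i j; rewrite !mxE.
Qed.

HB.instance Definition _ :=
  Lmodule_hasFinDim.Build R (rmat R) rmat_vect_axiom.

End RealMatrices.

(* The indices 1, ..., 4 of the usual notation. *)
Definition i1 : 'I_4 := @Ordinal 4 0 isT.
Definition i2 : 'I_4 := @Ordinal 4 1 isT.
Definition i3 : 'I_4 := @Ordinal 4 2 isT.
Definition i4 : 'I_4 := @Ordinal 4 3 isT.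

(* i and j lie in the same block of the partition {1, 2} | {3, 4}. *)
Definition same_block (i j : 'I_4) : bool := (i < 2)%N == (j < 2)%N.

Section LieAlgebras.
Variable R : realType.
Local Notation M4 := 'M[R[i]]_4.

Definition J22 : M4 := \matrix_(i, j) (if i == j then (-1) ^+ (2 <= i)%N else 0).

Definition SU22 : set M4 :=
  [set g : M4 | g ^t* *m J22 *m g = J22 /\ \det g = 1].

Definition herm_defect (X : rmat R) : rmat R :=
  (X : M4) ^t* *m J22 + J22 *m (X : M4).
Definition trace_part (X : rmat R) : rmat R := (\tr (X : M4))%:M.
Definition offblock_part (X : rmat R) : rmat R :=
  \matrix_(i, j) (if same_block i j then 0 else (X : M4) i j).
Definition offdiag_part (X : rmat R) : rmat R :=
  \matrix_(i, j) (if i == j then 0 else (X : M4) i j).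

Fact herm_defect_linear : linear herm_defect.
Proof.
move=> a X Y; rewrite /herm_defect !rmat_scaleE.
apply/matrixP => i j; rewrite !mxE mulrDr !mulr_sumr -!big_split /=.
apply: eq_bigr => k _; rewrite !mxE rmorphD rmorphM /=.
have -> : (a%:C%C)^* = a%:C%C :> R[i] by exact: conjc_real.
by rewrite mulrDl mulrDr -!mulrA [X in _ + (X + _)]mulrCA addrACA.
Qed.
HB.instance Definition _ :=
  GRing.isLinear.Build R (rmat R) (rmat R) _ herm_defect herm_defect_linear.

Fact trace_part_linear : linear trace_part.
Proof.
move=> a X Y; rewrite /trace_part !rmat_scaleE linearP /=.
by apply/matrixP => i j; rewrite !mxE mulrnDl mulrnAr.
Qed.
HB.instance Definition _ :=
  GRing.isLinear.Build R (rmat R) (rmat R) _ trace_part trace_part_linear.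

Fact offblock_part_linear : linear offblock_part.
Proof.
move=> a X Y; rewrite /offblock_part; apply/matrixP => i j.
by rewrite !mxE; case: ifP; rewrite ?mulr0 ?addr0.
Qed.
HB.instance Definition _ :=
  GRing.isLinear.Build R (rmat R) (rmat R) _ offblock_part
    offblock_part_linear.

Fact offdiag_part_linear : linear offdiag_part.
Proof.
move=> a X Y; rewrite /offdiag_part; apply/matrixP => i j.
by rewrite !mxE; case: ifP; rewrite ?mulr0 ?addr0.
Qed.
HB.instance Definition _ :=
  GRing.isLinear.Build R (rmat R) (rmat R) _ offdiag_part offdiag_part_linear.

Definition su22 : {vspace rmat R} :=
  (lker (linfun herm_defect) :&: lker (linfun trace_part))%VS.
Definition k22 : {vspace rmat R} := (su22 :&: lker (linfun offblock_part))%VS.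
Definition t22 : {vspace rmat R} := (su22 :&: lker (linfun offdiag_part))%VS.

Lemma su22P (X : rmat R) :
  reflect ((X : M4) ^t* *m J22 + J22 *m (X : M4) = 0 /\ \tr (X : M4) = 0)
          (X \in su22).
Proof.
rewrite memv_cap !memv_ker !lfunE /=.
apply: (iffP andP) => [[/eqP h /eqP t]|[h t]]; split=> //.
- by move/matrixP/(_ 0 0): t; rewrite !mxE eqxx mulr1n.
- exact/eqP.
- by rewrite /trace_part t raddf0.
Qed.

Lemma k22P (X : rmat R) :
  reflect (X \in su22 /\ forall i j, ~~ same_block i j -> (X : M4) i j = 0)
          (X \in k22).
Proof.
rewrite [X \in k22]memv_cap memv_ker lfunE /=.
apply: (iffP andP) => [[h /eqP o]|[h o]]; split=> //.
- by move=> i j /negPf b; move/matrixP/(_ i j): o; rewrite !mxE b.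
- by apply/eqP/matrixP => i j; rewrite !mxE; case: ifPn => // /o.
Qed.

Lemma t22P (X : rmat R) :
  reflect (X \in su22 /\ forall i j, i != j -> (X : M4) i j = 0)
          (X \in t22).
Proof.
rewrite [X \in t22]memv_cap memv_ker lfunE /=.
apply: (iffP andP) => [[h /eqP o]|[h o]]; split=> //.
- by move=> i j /negPf b; move/matrixP/(_ i j): o; rewrite !mxE b.
- by apply/eqP/matrixP => i j; rewrite !mxE; case: ifPn => // /o.
Qed.

Lemma t22_sub_k22 : (t22 <= k22)%VS.
Proof.
apply/subvP => X /t22P[s d]; apply/k22P; split=> // i j nb; apply: d.
by apply: contraNneq nb => ->; rewrite /same_block eqxx.
Qed.

Lemma k22_sub_su22 : (k22 <= su22)%VS.
Proof. exact: capvSl. Qed.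

(* The real dual of a Lie subalgebra. *)
Definition dual (U : {vspace rmat R}) := 'Hom(subvs_of U, R^o).

(* The inclusion of U in W, when U is a subspace of W. *)
Definition incl (U W : {vspace rmat R}) : 'Hom(subvs_of U, subvs_of W) :=
  linfun (vsproj W \o vsval).

Lemma inclE (U W : {vspace rmat R}) (X : subvs_of U) :
  (U <= W)%VS -> vsval (incl U W X) = vsval X.
Proof. by move=> /subvP UW; rewrite lfunE /= vsprojK ?UW ?subvsP. Qed.

(* In the next two definitions, vsproj only retypes an element of su22: see
   bracketE and AdE. *)
Definition bracket (X Y : subvs_of su22) : subvs_of su22 :=
  vsproj su22 ((vsval X : M4) *m (vsval Y : M4)
               - (vsval Y : M4) *m (vsval X : M4)).

Definition Ad_fun (g : M4) (X : subvs_of su22) : subvs_of su22 :=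
  vsproj su22 (g *m (vsval X : M4) *m invmx g).

Lemma bracketE (X Y : subvs_of su22) :
  vsval (bracket X Y) = (vsval X : M4) *m (vsval Y : M4)
                        - (vsval Y : M4) *m (vsval X : M4) :> M4.
Proof.
rewrite /bracket vsprojK //.
move: (subvsP X) (subvsP Y) => /su22P[hX tX] /su22P[hY tY].
apply/su22P; split; last by rewrite linearB /= mxtrace_mulC subrr.
move: (vsval X : M4) (vsval Y : M4) hX hY {tX tY} => A B hA hB.
have eA : A ^t* *m J22 = - (J22 *m A) by apply/eqP; rewrite -addr_eq0 hA.
have eB : B ^t* *m J22 = - (J22 *m B) by apply/eqP; rewrite -addr_eq0 hB.
rewrite linearB /= map_mxB !trmx_mul !map_mxM /= mulmxBl -!mulmxA eA eB.
by rewrite !mulmxN !mulmxA eA eB !mulNmx !opprK mulmxBr !mulmxA -opprB addNr.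
Qed.

Lemma J22K : J22 *m J22 = 1%:M :> M4.
Proof.
apply/matrixP => i j; rewrite !mxE (bigD1 i) //= big1 => [|k ki].
  by rewrite !mxE eqxx addr0; case: eqP => [->|]; rewrite ?mulr0 // -expr2
             sqrr_sign.
by rewrite !mxE eq_sym (negPf ki) mul0r.
Qed.

Lemma AdE (g : M4) (X : subvs_of su22) :
  SU22 g -> vsval (Ad_fun g X) = g *m (vsval X : M4) *m invmx g :> M4.
Proof.
move=> [gJ g1]; have gu : g \in unitmx by rewrite unitmxE g1 unitr1.
rewrite /Ad_fun vsprojK //; move: (subvsP X) => /su22P[hX tX].
apply/su22P; split; last first.
  by rewrite mxtrace_mulC mulmxA mulVmx // mul1mx.
move: (vsval X : M4) hX {tX} => A hA.
have eA : A ^t* *m J22 = - (J22 *m A) by apply/eqP; rewrite -addr_eq0 hA.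
have e1 : g ^t* *m J22 = J22 *m invmx g by rewrite -[in RHS]gJ mulmxK.
have e2 : (invmx g) ^t* *m J22 = J22 *m g.
  have gsu : g ^t* *m (invmx g) ^t* = 1%:M.
    by rewrite -map_mxM -trmx_mul mulVmx // trmx1 map_mx1.
  have /mulmx1C gsu' := gsu.
  by rewrite -[in LHS]gJ !mulmxA gsu' mul1mx.
rewrite !trmx_mul !map_mxM -!mulmxA e1 (mulmxA (A ^t*)) eA mulNmx mulmxN.
by rewrite !mulmxA e2 addNr.
Qed.

Fact bracket_linear X : linear (bracket X).
Proof.
move=> a Y Z; rewrite /bracket -linearP /=; congr (vsproj _ _).
rewrite !rmat_scaleE mulmxDr mulmxDl -scalemxAl -scalemxAr scalerBr.
by rewrite opprD addrACA.
Qed.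
HB.instance Definition _ X :=
  GRing.isLinear.Build R (subvs_of su22) (subvs_of su22) _ (bracket X)
    (bracket_linear X).

Fact Ad_linear g : linear (Ad_fun g).
Proof.
move=> a Y Z; rewrite /Ad_fun -linearP /=; congr (vsproj _ _).
by rewrite !rmat_scaleE mulmxDr mulmxDl -scalemxAr -scalemxAl.
Qed.
HB.instance Definition _ g :=
  GRing.isLinear.Build R (subvs_of su22) (subvs_of su22) _ (Ad_fun g)
    (Ad_linear g).

Definition ad (X : subvs_of su22) : 'End(subvs_of su22) := linfun (bracket X).
Definition Ad (g : M4) : 'End(subvs_of su22) := linfun (Ad_fun g).

Definition lfun_trace (V : vectType R) (f : 'End(V)) : R :=
  \sum_i coord (vbasis {:V}) i (f (vbasis {:V})`_i).

Definition killing (X Y : subvs_of su22) : R :=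
  lfun_trace (ad X \o ad Y)%VF.

(* lam in U^* corresponds to f in W^* under the inclusion of U^* in W^* given by
   the Killing form: both are the pairing with one and the same element of U. *)
Definition killing_extends (U W : {vspace rmat R}) (lam : dual U) (f : dual W)
    : Prop :=
  exists H : subvs_of U,
    (forall Y : subvs_of U,
       lam Y = killing (incl U su22 H) (incl U su22 Y)) /\
    (forall X : subvs_of W,
       f X = killing (incl U su22 H) (incl W su22 X)).

Definition estar_fun (j : 'I_4) (H : subvs_of t22) : R^o :=
  complex.Im ((vsval H : M4) j j).

Fact estar_linear j : linear (estar_fun j).
Proof.
move=> a X Y; rewrite /estar_fun linearP /= mxE rmat_scaleE mxE.
by case: (vsval X j j) => ? ?; case: (vsval Y j j) => ? ? /=;
   rewrite mul0r addr0.
Qed.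
HB.instance Definition _ j :=
  GRing.isLinear.Build R (subvs_of t22) R^o _ (estar_fun j) (estar_linear j).

Definition estar (j : 'I_4) : dual t22 := linfun (estar_fun j).

(* xi_1 e_1^* + ... + xi_4 e_4^*; coordinates are unique only under the
   normalization xi_1 + ... + xi_4 = 0. *)
Definition tstar (xi : 'rV[R]_4) : dual t22 := \sum_j xi 0 j *: estar j.

Definition normalized (xi : 'rV[R]_4) : Prop := \sum_j xi 0 j = 0.

Definition tplus : set (dual t22) :=
  [set tstar xi | xi in [set xi | [/\ normalized xi,
     xi 0 i1 >= xi 0 i2 & xi 0 i3 >= xi 0 i4]]].

Definition holomorphic_chamber (xi : 'rV[R]_4) : Prop :=
  [/\ normalized xi, xi 0 i1 >= xi 0 i2, xi 0 i2 > xi 0 i3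
    & xi 0 i3 >= xi 0 i4].

(* (g . f)(X) = f(Ad(g^-1) X) *)
Definition coadjoint_orbit (f : dual su22) : set (dual su22) :=
  [set (f \o Ad (invmx g))%VF | g in SU22].

(* G . Lambda, for Lambda in t^* viewed in g^*. *)
Definition orbit_of (Lam : dual t22) : set (dual su22) :=
  [set f | exists2 f0, killing_extends Lam f0 & coadjoint_orbit f0 f].

Definition Phi_K (f : dual su22) : dual k22 := (f \o incl k22 su22)%VF.

(* Phi_K(O) `&` t^*_+, the intersection being taken in k^*. *)
Definition Delta_K (O : set (dual su22)) : set (dual t22) :=
  [set xi | tplus xi /\ exists2 f, (Phi_K @` O) f & killing_extends xi f].

End LieAlgebras.

(* Main.v *)
(* The Killing form of su(2,2) is 8 Re tr(XY), so Delta_K(G.Lam) consists of the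
   ordered xi such that, for some g in SU(2,2), the block diagonal part of
   X = g diag(Lam) g^-1 is diag(xi).

   Necessity: on a subspace of C^4 contained in one of the two blocks, the
   indefinite hermitian form attached to X is read off from xi, and in the basis
   given by the columns of g it is read off from Lam.  Counting signs
   (Courant-Fischer for the indefinite form) yields the bounds on the xi_i; the
   same argument on the mixed bivectors in Lambda^2 C^4 yields the bounds on
   the xi_i + xi_j, which are the remaining inequalities.

   Sufficiency: write g = k' exp(p) k with k, k' in K and exp(p) a product of two
   commuting boosts.  With A, B, a, b the gaps Lam_1 - Lam_2, Lam_3 - Lam_4,
   xi_1 - xi_2, xi_3 - xi_4, and s = (xi_1 + xi_2) - (Lam_1 + Lam_2), one has to
   solve two real equations.  If s <= min (A + a, B + b), a single boost is enough
   and the equations reduce to the intermediate value theorem in one variable.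
   Otherwise one may assume B + b < s and B + b <= A + a, and two one-parameter
   families of diagonal configurations turn one of the equations into
   E(P, m) = 0 with E convex in P and concave in m; the zero set of E contains a
   curve along which the other equation changes sign. *)

From HB Require Import structures.
Require Import Defs.
From mathcomp Require Import all_boot all_order all_algebra.
From mathcomp Require Import classical_sets reals.
From mathcomp Require Import complex ring lra.

Set Implicit Arguments.
Unset Strict Implicit.
Unset Printing Implicit Defensive.

Import Order.TTheory GRing.Theory Num.Theory.
Local Open Scope ring_scope.
Local Open Scope sesquilinear_scope.
Local Open Scope classical_set_scope.

(** * The Killing form of su(2,2) *)

Lemma linear_sumZ (K : nzRingType) (V W : lmodType K) (s : GRing.Scale.law K W)
    (h : V -> W) (J : finType) (a : J -> K) (c : J -> V) :
  linear_for s h -> h (\sum_j a j *: c j) = \sum_j s (a j) (h (c j)).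
Proof.
move=> hl; pose h' : {linear V -> W | s} :=
  HB.pack h (GRing.isLinear.Build K V W s h hl).
by rewrite -[h]/(h' : V -> W) linear_sum; apply: eq_bigr => j _; rewrite linearZ.
Qed.

(** The identity tr(fg) = tr(gf) in coordinates. It moves the trace over su(2,2), whose basis is not
    explicit, to the matrix units of gl_4. *)
Lemma coord_trace_swap (K : comNzRingType) (V W : lmodType K) (I J : finType)
    (b : I -> V) (p : I -> V -> K) (c : J -> W) (q : J -> W -> K)
    (f : W -> V) (g : V -> W) :
  (forall i, scalar (p i)) -> (forall j, scalar (q j)) -> linear f -> linear g ->
  (forall v, v = \sum_i p i v *: b i) -> (forall w, w = \sum_j q j w *: c j) ->
  \sum_i p i (f (g (b i))) = \sum_j q j (g (f (c j))).
Proof.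
move=> pl ql fl gl pb qc.
transitivity (\sum_i \sum_j q j (g (b i)) * p i (f (c j))).
  apply: eq_bigr => i _; rewrite [in LHS](qc (g (b i))) (linear_sumZ _ _ fl).
  exact: (linear_sumZ (W := K^o) _ _ (pl i)).
rewrite exchange_big /=; apply: eq_bigr => j _.
rewrite [in RHS](pb (f (c j))) (linear_sumZ _ _ gl).
rewrite (linear_sumZ (W := K^o) _ _ (ql j)) /=.
by apply: eq_bigr => i _; rewrite mulrC.
Qed.

Section KillingForm.
Variable R : realType.
Local Notation M4 := 'M[R[i]]_4.

Definition rmat_coord (k : 'I_4 * 'I_4 * bool) (X : rmat R) : R :=
  let x := (X : M4) k.1.1 k.1.2 in if k.2 then complex.Re x else complex.Im x.

Fact rmat_coord_linear k : scalar (rmat_coord k).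
Proof.
move=> a X Y; rewrite /rmat_coord rmat_scaleE !mxE.
case: (X _ _) => ? ?; case: (Y _ _) => ? ? /=.
by case: k.2; rewrite mul0r ?subr0 ?addr0.
Qed.
HB.instance Definition _ k :=
  GRing.isLinear.Build R (rmat R) R *%R (rmat_coord k) (rmat_coord_linear k).

Definition rmat_basis (k : 'I_4 * 'I_4 * bool) : rmat R :=
  (if k.2 then 1 else 'i%C) *: (delta_mx k.1.1 k.1.2 : M4).

Lemma rmat_basisE X : X = \sum_k rmat_coord k X *: rmat_basis k.
Proof.
apply/matrixP => i j.
have -> : (\sum_k rmat_coord k X *: rmat_basis k : M4) i j =
  \sum_k (rmat_coord k X *: rmat_basis k : M4) i j by rewrite summxE.
rewrite -(pair_bigA _ (fun p e => (rmat_coord (p, e) X *: rmat_basis (p, e) : M4) i j)) /=.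
rewrite (bigD1 (i, j)) //= [X in _ + X]big1 ?addr0 => [|[i' j'] ne].
  rewrite big_bool /= !rmat_scaleE !mxE /rmat_coord /= !eqxx /= !mulr1.
  by case: (X i j) => u v; apply/eqP; rewrite eq_complex /=;
    rewrite !(mul0r,mulr0,mulr1,subr0,addr0,add0r) !eqxx.
rewrite big1 // => e _; rewrite rmat_scaleE !mxE /=.
have [ii|_] := eqVneq i i'; last by rewrite /= !mulr0.
have [jj|_] := eqVneq j j'; last by rewrite /= !mulr0.
by rewrite ii jj eqxx in ne.
Qed.

(* Real-linear projection of gl_4 onto su(2,2): half of Y is the part of Z that
   is skew for J22, and its trace is spread over the four diagonal entries. *)
Definition su22_part (Z : M4) : M4 :=
  let Y := Z - J22 R *m Z ^t* *m J22 R in 2^-1 *: Y - (8^-1 * \tr Y)%:M.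

Lemma conjc_natV n : ((n%:R)^-1 : R[i])^* = n%:R^-1.
Proof. by rewrite fmorphV rmorph_nat. Qed.

Lemma trmxC_J22 : (J22 R) ^t* = J22 R.
Proof.
apply/matrixP => i j; rewrite !mxE eq_sym; case: eqP => [->|_]; last first.
  exact: rmorph0.
by rewrite rmorphXn /= rmorphN rmorph1.
Qed.

Lemma trmxC_mul (A B : M4) : (A *m B) ^t* = B ^t* *m A ^t*.
Proof. by rewrite trmx_mul map_mxM. Qed.

Lemma trmxCK (A : M4) : (A ^t*) ^t* = A.
Proof. by apply/matrixP => i j; rewrite !mxE conjCK. Qed.

Lemma mxtrace_trmxC (A : M4) : \tr (A ^t*) = (\tr A)^*.
Proof.
by rewrite /mxtrace rmorph_sum /=; apply: eq_bigr => i _; rewrite !mxE.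
Qed.

Lemma su22_part_in Z : (su22_part Z : rmat R) \in su22 R.
Proof.
pose Y := Z - J22 R *m Z ^t* *m J22 R.
have YJ : Y ^t* *m J22 R = - (J22 R *m Y).
  rewrite /Y linearB /= map_mxB !trmxC_mul trmxCK trmxC_J22.
  rewrite mulmxBl mulmxBr -!mulmxA J22K mulmx1 !mulmxA J22K mul1mx.
  by rewrite opprB.
have trY : (\tr Y)^* = - \tr Y.
  rewrite /Y linearB /= rmorphB /= [in RHS]mxtrace_mulC mulmxA J22K mul1mx.
  rewrite [in LHS]mxtrace_mulC mulmxA J22K mul1mx mxtrace_trmxC opprB.
  by rewrite conjCK.
rewrite /su22_part -/Y; move: Y YJ trY => Y YJ trY.
apply/su22P; split; last first.
  rewrite linearB /= linearZ /= mxtrace_scalar -mulrnAl.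
  apply/eqP; rewrite subr_eq0; apply/eqP; congr (_ * _).
  by field.
rewrite linearB /= map_mxB linearZ /= map_mxZ /= tr_scalar_mx.
rewrite map_scalar_mx /= conjc_natV mulmxBl -scalemxAl YJ mulmxBr.
rewrite -scalemxAr rmorphM /= conjc_natV trY mulrN (raddfN scalar_mx) /= mulNmx opprK.
by rewrite scalerN scalar_mxC addrACA addNr subrr addr0.
Qed.

Fact su22_part_linear : linear (su22_part : rmat R -> rmat R).
Proof.
move=> a X Y; rewrite /su22_part !rmat_scaleE.
have -> : (a%:C%C *: (X : M4) + Y) ^t* = a%:C%C *: X ^t* + Y ^t*.
  by rewrite linearP /= map_mxD map_mxZ; congr (_ *: _ + _); exact: conjc_real.
have -> : a%:C%C *: (X : M4) + Y
    - J22 R *m (a%:C%C *: X ^t* + Y ^t*) *m J22 R =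
  a%:C%C *: (X - J22 R *m X ^t* *m J22 R) + (Y - J22 R *m Y ^t* *m J22 R).
  rewrite mulmxDr mulmxDl -scalemxAr -scalemxAl scalerBr opprD addrACA.
  by [].
move: (X - _) (Y - _) => U V.
rewrite linearP /= (linearP (@mxtrace _ 4)) /= mulrDr mulrCA raddfD /=.
rewrite scalerBr opprD addrACA; congr (_ - _ + _).
by rewrite scale_scalar_mx.
Qed.
HB.instance Definition _ :=
  GRing.isLinear.Build R (rmat R) (rmat R) _ su22_part su22_part_linear.

Lemma delta_sandwich (A B : M4) i j :
  (A *m delta_mx i j *m B) i j = A i i * B j j.
Proof.
rewrite mxE (bigD1 j) //= big1 ?addr0 => [|k kj].
  rewrite mxE (bigD1 i) //= big1 ?addr0 => [|k ki].
    by rewrite mxE !eqxx mulr1.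
  by rewrite mxE (negPf ki) mulr0.
rewrite mxE big1 ?mul0r // => l _.
by rewrite mxE (negPf kj) andbF mulr0.
Qed.

(** Expand [X, [Y, Z]] = XYZ + ZYX - XZY - YZX; the map Z |-> AZB has trace tr A tr B, and 8 is
    twice the size of the matrices. *)
Lemma trace_commutator2 (X Y : M4) :
  \sum_i \sum_j ((X *m (Y *m delta_mx i j - delta_mx i j *m Y)
     - (Y *m delta_mx i j - delta_mx i j *m Y) *m X) : M4) i j =
  8 * \tr (X *m Y) - 2 * (\tr X * \tr Y).
Proof.
have E i j : ((X *m (Y *m delta_mx i j - delta_mx i j *m Y)
     - (Y *m delta_mx i j - delta_mx i j *m Y) *m X) : M4) i j =
   (X *m Y) i i + (Y *m X) j j - (X i i * Y j j + Y i i * X j j).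
  have -> : X *m (Y *m delta_mx i j - delta_mx i j *m Y)
     - (Y *m delta_mx i j - delta_mx i j *m Y) *m X =
     (X *m Y) *m delta_mx i j *m 1%:M + 1%:M *m delta_mx i j *m (Y *m X)
     - (X *m delta_mx i j *m Y + Y *m delta_mx i j *m X).
    rewrite mulmx1 mul1mx mulmxBr mulmxBl opprB !mulmxA opprD.
    by rewrite [RHS]addrACA.
  have H (A B C D : M4) : (A + B - (C + D)) i j = A i j + B i j - (C i j + D i j).
    by rewrite !mxE.
  by rewrite H !delta_sandwich !mxE !eqxx !(mulr1, mul1r).
under eq_bigr do under eq_bigr do rewrite E.
transitivity (\sum_(i < 4) (4 * (X *m Y) i i + \tr (Y *m X)
    - (X i i * \tr Y + Y i i * \tr X))).
  apply: eq_bigr => i _; rewrite big_split /= big_split /= sumr_const card_ord.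
  rewrite sumrN big_split /= -!mulr_sumr mulr_natl.
  by [].
rewrite big_split /= big_split /= -mulr_sumr sumr_const card_ord sumrN.
rewrite big_split /= -!mulr_suml -!/(\tr _) (mxtrace_mulC Y X) -mulr_natl.
by ring.
Qed.

Lemma commutator_linear (A U V : M4) a :
  A *m (a *: U + V) - (a *: U + V) *m A =
  a *: (A *m U - U *m A) + (A *m V - V *m A).
Proof.
by rewrite mulmxDr mulmxDl -scalemxAr -scalemxAl opprD addrACA -scalerBr.
Qed.

Lemma su22_part_id (Z : rmat R) : Z \in su22 R -> su22_part Z = Z.
Proof.
move=> /su22P[hZ tZ]; rewrite /su22_part.
have -> : J22 R *m (Z : M4) ^t* *m J22 R = - (Z : M4).
  rewrite -mulmxA (_ : _ *m J22 R = - (J22 R *m (Z : M4))).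
    by rewrite mulmxN mulmxA J22K mul1mx.
  by apply/eqP; rewrite -addr_eq0 hZ.
rewrite opprK mxtraceD tZ addr0 mulr0 raddf0 subr0.
by apply/matrixP => i j; rewrite !mxE; field.
Qed.

Definition ad2 (A B Z : M4) : M4 :=
  A *m (B *m Z - Z *m B) - (B *m Z - Z *m B) *m A.

Lemma ad2_linear A B a U V : ad2 A B (a *: U + V) = a *: ad2 A B U + ad2 A B V.
Proof. by rewrite /ad2 !commutator_linear. Qed.

Lemma ad2_scalar A B a : ad2 A B a%:M = 0.
Proof. by rewrite /ad2 scalar_mxC subrr mulmx0 mul0mx subrr. Qed.

Lemma ad2Z A B a U : ad2 A B (a *: U) = a *: ad2 A B U.
Proof.
by rewrite -[a *: U]addr0 ad2_linear -(raddf0 scalar_mx) ad2_scalar addr0.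
Qed.

Lemma ad2B A B U V : ad2 A B (U - V) = ad2 A B U - ad2 A B V.
Proof. by rewrite -scaleN1r addrC ad2_linear scaleN1r addrC. Qed.

(** The trace correction in [su22_part] is scalar, hence killed by commutators. *)
Lemma ad2_su22_part A B Z :
  ad2 A B (su22_part Z) = 2^-1 *: (ad2 A B Z - ad2 A B (J22 R *m Z ^t* *m J22 R)).
Proof.
by rewrite /su22_part ad2B ad2_scalar [LHS]subr0 ad2Z ad2B.
Qed.

(* Z |-> J Z^* J is antilinear, so its contributions at Z and iZ cancel: the
   trace over the real form is half the real trace over gl_4. *)
Lemma ad2_real_trace A B Z i j :
  complex.Re (ad2 A B (su22_part Z) i j)
  + complex.Im (ad2 A B (su22_part ('i%C *: Z)) i j) =
  complex.Re (ad2 A B Z i j).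
Proof.
have iZ : ('i%C *: Z) ^t* = - 'i%C *: Z ^t*.
  rewrite linearZ /= map_mxZ; congr (_ *: _).
  by apply/eqP; rewrite eq_complex /= oppr0 !eqxx.
move: (ad2_su22_part A B Z) (ad2_su22_part A B ('i%C *: Z)).
move: (su22_part Z) (su22_part ('i%C *: Z)) => Z1 Z2 -> ->.
rewrite (ad2Z A B 'i%C Z) iZ.
rewrite -(scalemxAr (- 'i%C) (J22 R) (Z ^t*)).
rewrite -(scalemxAl (- 'i%C) (J22 R *m Z ^t*) (J22 R)).
rewrite (ad2Z _ _ (- 'i%C)).
move: (ad2 A B Z) (ad2 A B (J22 R *m Z ^t* *m J22 R)) => U V.
rewrite !mxE.
have -> : (2^-1 : R[i]) = (2^-1)%:C%C by rewrite fmorphV rmorph_nat.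
case: (U i j) => t1 t2; case: (V i j) => u1 u2 /=.
by field.
Qed.

Lemma killingE (X Y : subvs_of (su22 R)) :
  killing X Y = 8 * complex.Re (\tr ((vsval X : M4) *m (vsval Y : M4))).
Proof.
move: (subvsP X) => /su22P[_ tX].
pose T := ad2 (vsval X) (vsval Y).
(* [f] extends ad X o ad Y to gl_4 through the projection onto su(2,2). Swapping [f] with the
   inclusion turns the trace over su(2,2) into one over the real basis of gl_4. *)
pose f (Z : rmat R) : subvs_of (su22 R) :=
  bracket X (bracket Y (vsproj (su22 R) (su22_part Z))).
have fl : linear f by move=> a u v; rewrite /f su22_part_linear !linearP.
have fT Z : vsval (f Z) = T (su22_part Z) :> M4.
  by rewrite /f /= !bracketE vsprojK // su22_part_in.
have fvs Z : f (vsval Z) = bracket X (bracket Y Z).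
  by rewrite /f (su22_part_id (subvsP Z)) vsvalK.
clearbody f.
have -> : killing X Y = \sum_i coord (vbasis {:subvs_of (su22 R)}) i
    (f (vsval (vbasis {:subvs_of (su22 R)})`_i)).
  by apply: eq_bigr => i _; rewrite fvs comp_lfunE !lfunE.
rewrite (coord_trace_swap (I := 'I__) (W := rmat R) (g := vsval)
    (p := fun i => coord (vbasis {:subvs_of (su22 R)}) i)
    _ rmat_coord_linear fl _ _ rmat_basisE); first last.
- by move=> v; rewrite -coord_vbasis ?memvf.
- by move=> a u v; rewrite linearP.
- by move=> i a u v; rewrite linearP.
pose E i j : M4 := delta_mx i j.
transitivity (\sum_i \sum_j complex.Re (T (E i j) i j)).
  rewrite -(pair_bigA _ (fun p e => rmat_coord (p, e) (vsval (f (rmat_basis (p, e)))))) /=.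
  rewrite -(pair_bigA _ (fun i j =>
    \sum_e rmat_coord (i, j, e) (vsval (f (rmat_basis (i, j, e)))))) /=.
  apply: eq_bigr => i _; apply: eq_bigr => j _.
  have reE X' : rmat_coord (i, j, true) X' = complex.Re ((X' : M4) i j) by [].
  have imE X' : rmat_coord (i, j, false) X' = complex.Im ((X' : M4) i j) by [].
  have b1 : rmat_basis (i, j, true) = E i j by rewrite /rmat_basis scale1r.
  have bi : rmat_basis (i, j, false) = 'i%C *: E i j by [].
  rewrite big_bool reE imE !fT b1 bi; exact: ad2_real_trace.
under eq_bigr do rewrite -raddf_sum.
rewrite -raddf_sum trace_commutator2 tX mul0r mulr0 subr0.
by case: (\tr _) => u v /=; ring.
Qed.
End KillingForm.

(** * From coadjoint orbits to matrices *)

Section Reduction.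
Variable R : realType.
Local Notation M4 := 'M[R[i]]_4.

Definition rdiag (c : 'rV[R]_4) : M4 := diag_mx (map_mx (real_complex R) c).

Lemma rdiagE c i j : rdiag c i j = if i == j then (c 0 i)%:C%C else 0.
Proof. by rewrite !mxE; case: eqP => [->|_]; rewrite ?mulr1n ?mulr0n. Qed.

Lemma JE (i j : 'I_4) : J22 R i j = if i == j then (-1) ^+ (2 <= i)%N else 0.
Proof. by rewrite mxE. Qed.

Lemma mulJmx (A : M4) i j : (J22 R *m A) i j = (-1) ^+ (2 <= i)%N * A i j.
Proof.
rewrite mxE (bigD1 i) //= big1 ?addr0 => [|k ki]; rewrite JE ?eqxx //.
by rewrite eq_sym (negPf ki) mul0r.
Qed.

Lemma mulmxJ (A : M4) i j : (A *m J22 R) i j = A i j * (-1) ^+ (2 <= j)%N.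
Proof.
rewrite mxE (bigD1 j) //= big1 ?addr0 => [|k kj]; rewrite JE ?eqxx //.
by rewrite (negPf kj) mulr0.
Qed.

Lemma idiag_t22 (c : 'rV[R]_4) :
  normalized c -> ('i%C *: rdiag c : rmat R) \in t22 R.
Proof.
move=> c0; apply/t22P; split; last first.
  by move=> i j /negPf ij; rewrite mxE rdiagE ij mulr0.
apply/su22P; split.
  apply/matrixP => i j; rewrite mxE mulJmx mulmxJ !mxE.
  have [->|ij] := eqVneq i j; last first.
    by rewrite mulr0n mulr0 rmorph0 mul0r mulr0 addr0.
  rewrite mulr1n mulrC -mulrDr.
  apply/eqP; rewrite mulf_eq0 expf_eq0 oppr_eq0 oner_eq0 andbF /=.
  by rewrite eq_complex /= !mul0r !mul1r !(subrr, subr0, addr0,add0r,mulr0,oppr0) addNr eqxx.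
rewrite linearZ /= /mxtrace.
have -> : \sum_i rdiag c i i = (\sum_i c 0 i)%:C%C.
  by rewrite rmorph_sum; apply: eq_bigr => i _; rewrite rdiagE eqxx.
by rewrite c0 mulr0.
Qed.

Lemma t22_idiag (X : rmat R) : X \in t22 R ->
  exists2 c : 'rV[R]_4, normalized c & (X = 'i%C *: rdiag c :> M4).
Proof.
move=> /t22P[/su22P[hX tX] dX].
have X0 i : complex.Re ((X : M4) i i) = 0.
  move/matrixP/(_ i i): hX; rewrite mxE mulJmx mulmxJ !mxE mulrC -mulrDr => /eqP.
  rewrite mulf_eq0 expf_eq0 oppr_eq0 oner_eq0 andbF /= eq_complex => /andP[/= + _].
  by case: (X i i) => u v /= /eqP; lra.
exists (\row_i complex.Im ((X : M4) i i)); last first.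
  apply/matrixP => i j; rewrite mxE rdiagE; case: eqP => [<-|/eqP ij].
    by rewrite mxE; case: (X i i) (X0 i) => u v /= ->; apply/eqP;
      rewrite eq_complex /=; apply/andP; split; apply/eqP; ring.
  by rewrite mulr0 dX.
rewrite /normalized; under eq_bigr do rewrite mxE.
by rewrite -raddf_sum -/(\tr (X : M4)) tX.
Qed.

Lemma mxtrace_idiag (c d : 'rV[R]_4) :
  \tr (('i%C *: rdiag c) *m ('i%C *: rdiag d)) = (- \sum_j c 0 j * d 0 j)%:C%C.
Proof.
rewrite /mxtrace -sumrN rmorph_sum /=; apply: eq_bigr => i _.
rewrite mxE (bigD1 i) //= big1 ?addr0 => [|k ki].
  rewrite [in LHS]mxE [X in _ * X]mxE !rdiagE eqxx; apply/eqP; rewrite eq_complex /=.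
  by apply/andP; split; apply/eqP; ring.
by rewrite [X in X * _]mxE !rdiagE eq_sym (negPf ki) mulr0 mul0r.
Qed.

Lemma tstarE (xi : 'rV[R]_4) (H : subvs_of (t22 R)) (c : 'rV[R]_4) :
  vsval H = 'i%C *: rdiag c :> M4 -> tstar xi H = \sum_j xi 0 j * c 0 j.
Proof.
move=> Hc; rewrite /tstar sum_lfunE; apply: eq_bigr => j _.
rewrite scale_lfunE lfunE /= /estar_fun Hc mxE rdiagE eqxx /=.
by congr (_ * _); rewrite mul0r mul1r add0r.
Qed.

Lemma t22_sub_su22 : (t22 R <= su22 R)%VS.
Proof. exact: capvSl. Qed.

(** On t the Killing form is -8 times the standard scalar product of the coordinates, whence the
    factor -1/8. *)
Lemma tstar_killing (xi : 'rV[R]_4) (H : subvs_of (t22 R)) : normalized xi ->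
  (forall Y : subvs_of (t22 R), tstar xi Y =
     killing (incl (t22 R) (su22 R) H) (incl (t22 R) (su22 R) Y)) <->
  vsval H = 'i%C *: rdiag (- 8^-1 *: xi) :> M4.
Proof.
move=> nxi; have [c nc Hc] := t22_idiag (subvsP H).
have kE (Y : subvs_of (t22 R)) d : vsval Y = 'i%C *: rdiag d :> M4 ->
    killing (incl (t22 R) (su22 R) H) (incl (t22 R) (su22 R) Y) =
    - (8 * \sum_j c 0 j * d 0 j).
  move=> Yd; rewrite killingE !inclE ?t22_sub_su22 // Hc Yd mxtrace_idiag /=.
  by rewrite mulrN.
split=> [h|Hxi Y]; last first.
  have [d nd Yd] := t22_idiag (subvsP Y).
  rewrite (tstarE _ Yd) (kE _ _ Yd) mulr_sumr -sumrN.
  apply: eq_bigr => j _.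
  have -> : c 0 j = - 8^-1 * xi 0 j.
    move/matrixP/(_ j j): Hxi; rewrite Hc !mxE eqxx !mulr1n.
    by move/eqP; rewrite eq_complex /= => /andP[_ /eqP]; lra.
  by field.
(* The two functionals differ by the pairing with [d]. Evaluated at [d] itself, which is normalized,
   the difference is a sum of squares. *)
pose d : 'rV[R]_4 := xi + 8 *: c.
have nd : normalized d.
  rewrite /normalized; under eq_bigr do rewrite !mxE.
  by rewrite big_split /= -mulr_sumr nxi nc mulr0 addr0.
have Yd : vsval (vsproj (t22 R) ('i%C *: rdiag d)) = 'i%C *: rdiag d :> M4.
  by rewrite vsprojK // idiag_t22.
have := h (vsproj (t22 R) ('i%C *: rdiag d)); rewrite (tstarE _ Yd) (kE _ _ Yd).
move/eqP; rewrite -subr_eq0 opprK mulr_sumr -big_split /=.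
have -> : \sum_i (xi 0 i * d 0 i + 8 * (c 0 i * d 0 i)) = \sum_i (d 0 i) ^+ 2.
  by apply: eq_bigr => i _; rewrite !mxE; ring.
rewrite psumr_eq0 => [/allP d0|i _]; last exact: sqr_ge0.
rewrite Hc; congr (_ *: rdiag _); apply/rowP => j; rewrite mxE.
have := d0 j (mem_index_enum _); rewrite sqrf_eq0 !mxE => /eqP; lra.
Qed.


(** * Orthogonality to k and the projection of the orbit *)

Definition block_part (S : rmat R) : rmat R :=
  \matrix_(i, j) if same_block i j then (S : M4) i j else 0.

Lemma same_blockC i j : same_block i j = same_block j i.
Proof. exact: eq_sym. Qed.

Lemma su22_skew (S : rmat R) i j : S \in su22 R -> same_block i j ->
  (S : M4) j i = - ((S : M4) i j)^*.
Proof.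
move=> /su22P[hS _] /eqP sij; move/matrixP/(_ j i): hS.
rewrite mxE mulJmx mulmxJ !mxE.
have -> : (2 <= j)%N = (2 <= i)%N by rewrite leqNgt -sij -leqNgt.
rewrite mulrC -mulrDr => /eqP; rewrite mulf_eq0 signr_eq0 /= addrC addr_eq0.
by move/eqP.
Qed.

Lemma block_part_k22 S : S \in su22 R -> block_part S \in k22 R.
Proof.
move=> Ssu; apply/k22P; split; last by move=> i j /negPf ij; rewrite mxE ij.
apply/su22P; split; last first.
  move/su22P: Ssu => [_ <-]; apply: eq_bigr => i _.
  by rewrite mxE /same_block eqxx.
apply/matrixP => i j; rewrite mxE mulJmx mulmxJ !mxE same_blockC.
case: ifP => [sij|_]; last by rewrite rmorph0 mul0r mulr0 addr0.
rewrite (su22_skew Ssu sij). rewrite rmorphN /= conjCK.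
have -> : (2 <= j)%N = (2 <= i)%N by rewrite leqNgt -(eqP sij) -leqNgt.
by rewrite mulNr mulrC addNr.
Qed.

(** The trace form is negative definite on k: pairing S with its own block part yields minus the sum
    of the squared moduli of the block entries. *)
Lemma k22_orthogonal (S : rmat R) : S \in su22 R ->
  (forall X : subvs_of (k22 R), complex.Re (\tr ((S : M4) *m (vsval X : M4))) = 0)
  <-> (forall i j, same_block i j -> (S : M4) i j = 0).
Proof.
move=> Ssu; split=> [h i j sij|h X]; last first.
  rewrite /mxtrace big1 // => i _; rewrite mxE big1 // => j _.
  have [sij|nij] := boolP (same_block i j); first by rewrite h ?mul0r.
  by have /k22P[_ ->] := subvsP X; rewrite ?mulr0 // same_blockC.
have := h (vsproj (k22 R) (block_part S)).
rewrite vsprojK ?block_part_k22 // /mxtrace.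
under eq_bigr do rewrite mxE.
rewrite raddf_sum /=; under eq_bigr do rewrite raddf_sum /=.
have E k l : complex.Re ((S : M4) k l * (block_part S : M4) l k) =
  - (if same_block k l then
       complex.Re ((S : M4) k l) ^+ 2 + complex.Im ((S : M4) k l) ^+ 2 else 0).
  rewrite mxE same_blockC; case: ifP => [skl|_]; last by rewrite mulr0 oppr0.
  by rewrite (su22_skew Ssu skl); case: (S k l) => u v /=; ring.
under eq_bigr do under eq_bigr do rewrite E.
have p k l : 0 <= (if same_block k l then
    complex.Re ((S : M4) k l) ^+ 2 + complex.Im ((S : M4) k l) ^+ 2 else 0).
  by case: ifP => // _; rewrite addr_ge0 ?sqr_ge0.
under eq_bigr do rewrite sumrN.
rewrite sumrN => /eqP; rewrite oppr_eq0 psumr_eq0 => [/allP/(_ i)|k _]; last first.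
  by apply: sumr_ge0 => l _.
rewrite mem_index_enum psumr_eq0 // => /(_ isT) /allP/(_ j).
rewrite mem_index_enum sij paddr_eq0 ?sqr_ge0 // !sqrf_eq0 => /(_ isT).
by case: (S i j) => u v /= /andP[/eqP-> /eqP->].
Qed.

(** Projection of the orbit onto xi, in matrix terms. The factor -i/8 of the Killing identification
    is common to both sides and is dropped. *)
Definition block_reachable (Lam xi : 'rV[R]_4) : Prop :=
  exists2 g, SU22 g & forall i j, same_block i j ->
    (g *m rdiag Lam *m invmx g) i j = rdiag xi i j.

Lemma SU22_invmx (g : M4) : SU22 g -> SU22 (invmx g).
Proof.
move=> [gJ g1]; have gu : g \in unitmx by rewrite unitmxE g1 unitr1.
split; last by rewrite det_inv g1 invr1.
have gsu : g ^t* *m (invmx g) ^t* = 1%:M.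
  by rewrite -map_mxM -trmx_mul mulVmx // trmx1 map_mx1.
have /mulmx1C gsu' := gsu.
by rewrite -[in LHS]gJ !mulmxA gsu' mul1mx -mulmxA mulmxV // mulmx1.
Qed.

(** Both functionals on k are Killing pairings, one with Ad(g) H by invariance of the trace, the
    other with H'. They agree exactly when the difference of these elements is orthogonal to k, that
    is, has zero block part. *)
Lemma coadjoint_projectionE (Lam xi : 'rV[R]_4) (H H' : subvs_of (t22 R)) (g : M4)
    (f0 : dual (su22 R)) :
  SU22 g ->
  vsval H = 'i%C *: rdiag (- 8^-1 *: Lam) :> M4 ->
  vsval H' = 'i%C *: rdiag (- 8^-1 *: xi) :> M4 ->
  (forall X : subvs_of (su22 R), f0 X =
     killing (incl (t22 R) (su22 R) H) (incl (su22 R) (su22 R) X)) ->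
  (forall X : subvs_of (k22 R), Phi_K (f0 \o Ad (invmx g))%VF X =
     killing (incl (t22 R) (su22 R) H') (incl (k22 R) (su22 R) X)) <->
  (forall i j, same_block i j ->
    (g *m rdiag Lam *m invmx g) i j = rdiag xi i j).
Proof.
move=> sg HL Hx hf0.
have gu : g \in unitmx by case: sg => _ g1; rewrite unitmxE g1 unitr1.
pose S : rmat R := vsval (Ad_fun g (incl (t22 R) (su22 R) H)) - vsval H'.
have Ssu : S \in su22 R.
  by rewrite rpredB ?subvsP // (subvP t22_sub_su22) ?subvsP.
have SE : S = (- 'i%C * 8^-1) *: (g *m rdiag Lam *m invmx g - rdiag xi) :> M4.
  have rZ (c : 'rV[R]_4) : 'i%C *: rdiag (- 8^-1 *: c) = (- 'i%C * 8^-1) *: rdiag c.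
    apply/matrixP => i j; rewrite [LHS]mxE [RHS]mxE !rdiagE.
    case: eqP => _; last by rewrite !mulr0.
    rewrite mxE rmorphM rmorphN fmorphV rmorph_nat.
    by rewrite [LHS]mulrA mulrN [in RHS]mulNr.
  have E1 : vsval (Ad_fun g (incl (t22 R) (su22 R) H)) =
      (- 'i%C * 8^-1) *: (g *m rdiag Lam *m invmx g) :> M4.
    by rewrite AdE // inclE ?t22_sub_su22 // HL rZ -scalemxAr -scalemxAl.
  have E2 : vsval H' = (- 'i%C * 8^-1) *: rdiag xi :> M4 by rewrite Hx rZ.
  by rewrite scalerBr -E1 -E2.
have <- : (forall i j, same_block i j -> (S : M4) i j = 0) <-> 
  (forall i j, same_block i j ->
    (g *m rdiag Lam *m invmx g) i j = rdiag xi i j).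
  have nz : - 'i%C * 8^-1 != 0 :> R[i].
    by rewrite mulf_neq0 ?invr_eq0 ?pnatr_eq0 // oppr_eq0 eq_complex /= oner_eq0 andbF.
  have SEij i j : (S : M4) i j =
      (- 'i%C * 8^-1) * ((g *m rdiag Lam *m invmx g) i j - rdiag xi i j).
    by rewrite SE [LHS]mxE [X in _ * X]mxE [X in _ * (_ + X)]mxE.
  split=> h i j sij; last by rewrite SEij h // subrr mulr0.
  have /eqP := h i j sij.
  by rewrite SEij mulf_eq0 (negPf nz) /= subr_eq0 => /eqP.
rewrite -(k22_orthogonal Ssu).
have E (X : subvs_of (k22 R)) : Phi_K (f0 \o Ad (invmx g))%VF X -
     killing (incl (t22 R) (su22 R) H') (incl (k22 R) (su22 R) X) =
   8 * complex.Re (\tr ((S : M4) *m (vsval X : M4))).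
  rewrite comp_lfunE comp_lfunE lfunE /= hf0 !killingE -mulrBr; congr (_ * _).
  rewrite !inclE ?t22_sub_su22 ?k22_sub_su22 ?subvv //.
  rewrite AdE; last exact: SU22_invmx.
  rewrite invmxK inclE ?k22_sub_su22 // -raddfB /=; congr (complex.Re _).
  have -> : (S : M4) = (g *m vsval H *m invmx g : M4) - (vsval H' : M4).
    by rewrite /S AdE // inclE //; exact: t22_sub_su22.
  rewrite mulmxBl raddfB /=; congr (_ - _).
  by rewrite !mulmxA [in LHS]mxtrace_mulC !mulmxA.
split=> h X.
  by apply: (mulfI (_ : (8 : R) != 0)); rewrite ?pnatr_eq0 // mulr0 -E h subrr.
by apply/eqP; rewrite -subr_eq0 E h mulr0.
Qed.

(** The codomain [R^o] lets the pairing with a fixed element be bundled as a member of the dual. *)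
Definition killing_form (X Y : subvs_of (su22 R)) : R^o := killing X Y.

Fact killing_form_linear X : linear (killing_form X).
Proof.
move=> a Y Z; rewrite /killing_form !killingE linearP /= rmat_scaleE.
rewrite mulmxDr -scalemxAr linearP /= raddfD /= mulrDr; congr (_ + _).
by case: (\tr _) => u v /=; rewrite mul0r subr0 mulrCA.
Qed.
HB.instance Definition _ X := GRing.isLinear.Build R (subvs_of (su22 R)) R^o _
  (killing_form X) (killing_form_linear X).

Lemma Delta_K_orbitE (Lam : 'rV[R]_4) : normalized Lam ->
  Delta_K (orbit_of (tstar Lam)) =
  [set tstar xi | xi in [set xi : 'rV[R]_4 | normalized xi /\
     [/\ xi 0 i1 >= xi 0 i2, xi 0 i3 >= xi 0 i4 & block_reachable Lam xi]]].
Proof.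
move=> nLam; apply/seteqP; split=> [_ [[xi [nxi o1 o2] <-]]|_ [xi [nxi [o1 o2 [g sg hg]]] <-]].
  move=> [_ [f1 [f0 [H [/(tstar_killing _ nLam) HL hf0]] [g sg <-]] <-]].
  move=> [H' [/(tstar_killing _ nxi) Hx hf]].
  exists xi => //; split=> //; split=> //; exists g => //.
  exact/(coadjoint_projectionE sg HL Hx hf0).
split; first by exists xi.
have tE (c : 'rV[R]_4) : normalized c -> exists2 H : subvs_of (t22 R),
    vsval H = 'i%C *: rdiag (- 8^-1 *: c) :> M4 &
    forall Y : subvs_of (t22 R), tstar c Y =
     killing (incl (t22 R) (su22 R) H) (incl (t22 R) (su22 R) Y).
  move=> nc.
  have tc : ('i%C *: rdiag (- 8^-1 *: c) : rmat R) \in t22 R.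
    apply: idiag_t22; rewrite /normalized.
    by under eq_bigr do rewrite mxE; rewrite -mulr_sumr nc mulr0.
  have Hc := vsprojK tc.
  by exists (vsproj (t22 R) ('i%C *: rdiag (- 8^-1 *: c))) => //; exact/tstar_killing.
have [H HL kL] := tE _ nLam; have [H' Hx kx] := tE _ nxi.
(* The extension of [tstar Lam] to su(2,2): the pairing with the element [H] of t that represents
   it. *)
pose f0 : dual (su22 R) :=
  (linfun (killing_form (incl (t22 R) (su22 R) H)) \o incl (su22 R) (su22 R))%VF.
have hf0 X : f0 X = killing (incl (t22 R) (su22 R) H) (incl (su22 R) (su22 R) X).
  by rewrite comp_lfunE lfunE.
move: f0 hf0 => f0 hf0.
exists (Phi_K (f0 \o Ad (invmx g))%VF).
  exists (f0 \o Ad (invmx g))%VF => //.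
  exists f0; first exact: (ex_intro _ H (conj kL hf0)).
  by exists g.
exists H'; split=> // X.
by move: X; apply/(coadjoint_projectionE sg HL Hx hf0).
Qed.

End Reduction.

(** * Necessity of the inequalities *)

Section TransportedForm.
Variables (C : numClosedFieldType) (n : nat) (J A : 'M[C]_n).

Lemma conj_transport :
  J^T = J -> A ^t* *m J *m A = J -> A^T *m J *m (A^T) ^t* = J.
Proof.
move=> JT AJ; apply: trmx_inj.
by rewrite !trmx_mul !trmxK JT -[in RHS]AJ mulmxA map_trmx.
Qed.

(** A acts on bivectors by Om |-> A Om A^T. By cyclicity of the trace the outer factors meet around
    J and are absorbed. *)
Lemma trace_congruence (D Om : 'M[C]_n) : A^T *m J *m (A^T) ^t* = J ->
  \tr ((A *m Om *m A^T) ^t* *m (J *m D *m (A *m Om *m A^T)) *m J) =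
  \tr (Om ^t* *m (A ^t* *m (J *m D) *m A *m Om) *m J).
Proof.
move=> AJ; rewrite trmx_mul map_mxM trmx_mul map_mxM.
set B := (A^T) ^t*; set X := J *m D; set A' := A ^t*; set P := Om ^t*.
transitivity (\tr (B *m (P *m A' *m X *m A *m Om *m (A^T *m J)))).
  by congr (\tr _); rewrite !mulmxA.
rewrite mxtrace_mulC -(mulmxA _ (A^T *m J) B) AJ.
by congr (\tr _); rewrite !mulmxA.
Qed.

End TransportedForm.

Section Necessity.
Variable R : realType.
Local Notation M4 := 'M[R[i]]_4.

Definition normsq (z : R[i]) : R := complex.Re z ^+ 2 + complex.Im z ^+ 2.

Lemma normsq_ge0 z : 0 <= normsq z.
Proof. by rewrite addr_ge0 ?sqr_ge0. Qed.

Lemma normsq_eq0 z : (normsq z == 0) = (z == 0).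
Proof. by rewrite paddr_eq0 ?sqr_ge0 // !sqrf_eq0 eq_complex. Qed.

Lemma normsq0 : normsq 0 = 0.
Proof. by apply/eqP; rewrite normsq_eq0. Qed.

Lemma normsqN z : normsq (- z) = normsq z.
Proof. by case: z => u v; rewrite /normsq /= !sqrrN. Qed.

Lemma conjM_normsq z : z^* * z = (normsq z)%:C%C.
Proof.
by case: z => u v; apply/eqP; rewrite eq_complex /=; apply/andP; split; apply/eqP;
  rewrite /normsq /=; ring.
Qed.

(** A matrix with four rows and three columns has rank at most three. This is the dimension count
    behind the sign arguments below. *)
Lemma exists_common_zero (F : fieldType) (a b c : 'cV[F]_4) :
  exists v : 'rV[F]_4,
    [/\ v != 0, (v *m a) 0 0 = 0, (v *m b) 0 0 = 0 & (v *m c) 0 0 = 0].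
Proof.
pose A := row_mx (row_mx a b) c.
have : kermx A != 0.
  rewrite -mxrank_eq0 mxrank_ker subn_eq0 -ltnNge.
  exact: leq_ltn_trans (rank_leq_col A) _.
case/rowV0Pn => v /sub_kermxP vA v0; exists v.
move: vA; rewrite !mul_mx_row -[0]row_mx0 -[X in _ = row_mx X _]row_mx0.
by case/eq_row_mx => /eq_row_mx[-> ->] ->; rewrite !mxE.
Qed.

Definition sgnJ (i : 'I_4) : R := (-1) ^+ (2 <= i)%N.

Lemma sgnJE (i : 'I_4) : ((-1) ^+ (2 <= i)%N : R[i]) = (sgnJ i)%:C%C.
Proof. by rewrite rmorphXn rmorphN rmorph1. Qed.

Lemma diag_form n (A : 'M[R[i]]_(4, n)) c t j :
  (A ^t* *m (J22 R *m (rdiag c - (t%:C%C)%:M) *m A)) j j =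
  (\sum_i sgnJ i * (c 0 i - t) * normsq (A i j))%:C%C.
Proof.
rewrite mxE rmorph_sum; apply: eq_bigr => i _.
have -> : (A ^t* ) j i = (A i j)^* by rewrite 2!mxE.
suff -> : (J22 R *m (rdiag c - (t%:C%C)%:M) *m A) i j =
    (sgnJ i * (c 0 i - t))%:C%C * A i j.
  by rewrite mulrCA conjM_normsq -rmorphM.
have DE k : (rdiag c - (t%:C%C)%:M) i k = if i == k then (c 0 i - t)%:C%C else 0.
  rewrite !mxE; case: eqP => [->|_]; rewrite ?mulr1n ?mulr0n ?subrr //.
  by rewrite rmorphB.
rewrite mxE (bigD1 i) //= big1 ?addr0 => [|k ki]; rewrite mulJmx DE.
  by rewrite eqxx sgnJE -rmorphM.
by rewrite eq_sym (negPf ki) mulr0 mul0r.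
Qed.

Lemma sum4 (V : nmodType) (F : 'I_4 -> V) : \sum_i F i = F i1 + F i2 + F i3 + F i4.
Proof.
rewrite !big_ord_recl big_ord0 addr0 !addrA.
by congr (F _ + F _ + F _ + F _); apply: val_inj.
Qed.

Section Group.
Variables (g : M4) (Lam xi : 'rV[R]_4).
Hypothesis sg : SU22 g.
Hypothesis hg : forall i j, same_block i j ->
  (g *m rdiag Lam *m invmx g) i j = rdiag xi i j.
Let h := invmx g.

Lemma SU22_unitmx : g \in unitmx.
Proof. by case: sg => _ g1; rewrite unitmxE g1 unitr1. Qed.

Lemma J22_conjugate (D : M4) :
  J22 R *m (g *m D *m h) = h ^t* *m (J22 R *m D) *m h.
Proof.
have hJ : h ^t* *m J22 R = J22 R *m g.
  have [hJh _] := SU22_invmx sg.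
  by rewrite -[h ^t* *m _]mulmx1 -(mulVmx SU22_unitmx) mulmxA hJh.
by rewrite !mulmxA hJ.
Qed.

Lemma shift_conjugate t :
  g *m rdiag Lam *m h - (t%:C%C)%:M = g *m (rdiag Lam - (t%:C%C)%:M) *m h.
Proof.
rewrite mulmxBr mulmxBl; congr (_ - _).
by rewrite scalar_mxC -mulmxA mulmxV ?SU22_unitmx // mulmx1.
Qed.

(** A column supported in one block meets only block entries of g diag(Lam) g^-1, and these are
    given by xi. *)
Lemma block_form n (A : 'M[R[i]]_(4, n)) t j :
  (forall i k, A i j != 0 -> A k j != 0 -> same_block i k) ->
  (A ^t* *m (J22 R *m (g *m rdiag Lam *m h - (t%:C%C)%:M) *m A)) j j =
  (\sum_i sgnJ i * (xi 0 i - t) * normsq (A i j))%:C%C.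
Proof.
move=> bA; rewrite mxE rmorph_sum; apply: eq_bigr => i _.
have -> : (A ^t* ) j i = (A i j)^* by rewrite 2!mxE.
have [A0|Ai] := eqVneq (A i j) 0.
  by rewrite A0 rmorph0 normsq0 mul0r mulr0.
suff -> : (J22 R *m (g *m rdiag Lam *m h - (t%:C%C)%:M) *m A) i j =
    (sgnJ i * (xi 0 i - t))%:C%C * A i j.
  by rewrite mulrCA conjM_normsq -rmorphM.
rewrite mxE (bigD1 i) //= big1 ?addr0 => [|k ki].
  rewrite mulJmx [X in _ * X * _]mxE hg /same_block ?eqxx // rdiagE eqxx.
  by rewrite !mxE eqxx mulr1n sgnJE -rmorphB -rmorphM.
have [A0|Ak] := eqVneq (A k j) 0; first by rewrite A0 mulr0.
rewrite mulJmx [X in _ * X * _]mxE hg ?bA // rdiagE eq_sym (negPf ki).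
by rewrite !mxE eq_sym (negPf ki) mulr0n subrr mulr0 mul0r.
Qed.

(** The hermitian form J(X - t), with X = g diag(Lam) g^-1, at a single vector: in the basis of the
    columns of g on the left, in the standard basis on the right. The shift t is free and is later
    set so that one term vanishes. *)
Lemma vector_form (v : 'rV[R[i]]_4) (t : R) :
  (forall i j, v 0 i != 0 -> v 0 j != 0 -> same_block i j) ->
  \sum_i sgnJ i * (Lam 0 i - t) * normsq ((v *m (row i h)^T) 0 0) =
  \sum_i sgnJ i * (xi 0 i - t) * normsq (v 0 i).
Proof.
move=> vb; apply: (fmorph_inj (real_complex R)) => /=.
have uE i : (v *m (row i h)^T) 0 0 = (h *m v^T) i 0.
  by rewrite !mxE; apply: eq_bigr => k _; rewrite !mxE mulrC.
under eq_bigr do rewrite uE.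
have vT i : v^T i 0 = v 0 i by rewrite mxE.
under [in RHS]eq_bigr do rewrite -vT.
rewrite -diag_form -block_form; last by move=> i k; rewrite !vT; exact: vb.
by rewrite shift_conjugate J22_conjugate trmx_mul map_mxM !mulmxA.
Qed.

(** The analogous form on bivectors. Each column of an off-block [Om] lies in a single block, so
    [block_form] applies column by column. *)
Lemma bivector_form (Om : M4) (t : R) :
  (forall i j, same_block i j -> Om i j = 0) ->
  \sum_j \sum_i sgnJ j * (sgnJ i * (Lam 0 i - t) * normsq ((h *m Om *m h^T) i j)) =
  \sum_j \sum_i sgnJ j * (sgnJ i * (xi 0 i - t) * normsq (Om i j)).
Proof.
move=> Ob; apply: (fmorph_inj (real_complex R)); rewrite !rmorph_sum /=.
have trJ (A : M4) : \tr (A *m J22 R) = \sum_j (sgnJ j)%:C%C * A j j.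
  by apply: eq_bigr => j _; rewrite mulmxJ sgnJE mulrC.
transitivity (\tr ((h *m Om *m h^T) ^t* *m (J22 R *m (rdiag Lam - (t%:C%C)%:M)
    *m (h *m Om *m h^T)) *m J22 R)).
  by rewrite trJ; apply: eq_bigr => j _; rewrite diag_form -rmorphM mulr_sumr.
transitivity (\tr (Om ^t* *m (J22 R *m (g *m rdiag Lam *m h - (t%:C%C)%:M)
    *m Om) *m J22 R)); last first.
  rewrite trJ; apply: eq_bigr => j _.
  rewrite block_form -?rmorphM ?mulr_sumr // => i k Oi Ok.
  have nb l : Om l j != 0 -> same_block l j = false.
    by move=> Ol; apply/negP => lj; rewrite Ob ?eqxx in Ol.
  move: (nb _ Oi) (nb _ Ok); rewrite /same_block.
  by do 3 case: (_ < 2)%N.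
have [hJ _] := SU22_invmx sg.
rewrite shift_conjugate J22_conjugate trace_congruence // conj_transport //.
by apply/matrixP => i j; rewrite !mxE eq_sym; case: eqP => // ->.
Qed.

(* The index p : 'I_4 enumerates the mixed bivectors e_1 /\ e_3, e_1 /\ e_4,
   e_2 /\ e_3, e_2 /\ e_4 of Lambda^2 C^4, seen as antisymmetric matrices. *)
Definition bivec_row (p : 'I_4) : 'I_4 := if (p < 2)%N then i1 else i2.
Definition bivec_col (p : 'I_4) : 'I_4 := if odd p then i4 else i3.

Definition bivec_basis (p : 'I_4) : M4 :=
  delta_mx (bivec_row p) (bivec_col p) - delta_mx (bivec_col p) (bivec_row p).

Definition bivec (v : 'rV[R[i]]_4) : M4 := \sum_p v 0 p *: bivec_basis p.

Definition bivec_coef (i j : 'I_4) : 'cV[R[i]]_4 :=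
  \col_p (h *m bivec_basis p *m h^T) i j.

Lemma bivec_coefE v i j :
  (h *m bivec v *m h^T) i j = (v *m bivec_coef i j) 0 0.
Proof.
rewrite /bivec mulmx_sumr mulmx_suml summxE mxE; apply: eq_bigr => p _.
by rewrite -scalemxAr -scalemxAl !mxE.
Qed.

Lemma bivecE v : [/\ bivec v i1 i3 = v 0 i1, bivec v i1 i4 = v 0 i2,
  bivec v i2 i3 = v 0 i3 & bivec v i2 i4 = v 0 i4].
Proof.
rewrite /bivec; split; rewrite summxE sum4 !mxE /=;
  by rewrite !(mulr0, mulr1, subr0, addr0, add0r).
Qed.

Lemma tr_bivec v : (bivec v)^T = - bivec v.
Proof.
rewrite /bivec linear_sum /= -sumrN; apply: eq_bigr => p _.
by rewrite linearZ /= /bivec_basis linearB /= !trmx_delta -scalerN opprB.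
Qed.

Lemma bivec_offblock v i j : same_block i j -> bivec v i j = 0.
Proof.
move=> sij; rewrite /bivec summxE big1 // => p _; rewrite !mxE.
suff H k l : same_block k l = false -> ((i == k) && (j == l)) = false.
  by rewrite !H ?subrr ?mulr0 // /bivec_row /bivec_col /same_block; case: ifP; case: ifP.
by move=> nkl; apply/negP => /andP[/eqP ik /eqP jl]; rewrite ik jl nkl in sij.
Qed.

Lemma bivec_identity (v : 'rV[R[i]]_4) (t : R) :
  let n (i j : 'I_4) := normsq ((v *m bivec_coef i j) 0 0) in
  (Lam 0 i1 + Lam 0 i2 - t) * n i1 i2 + (Lam 0 i3 + Lam 0 i4 - t) * n i3 i4
  - (Lam 0 i1 + Lam 0 i3 - t) * n i1 i3 - (Lam 0 i1 + Lam 0 i4 - t) * n i1 i4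
  - (Lam 0 i2 + Lam 0 i3 - t) * n i2 i3 - (Lam 0 i2 + Lam 0 i4 - t) * n i2 i4 =
  - ((xi 0 i1 + xi 0 i3 - t) * normsq (v 0 i1)
   + (xi 0 i1 + xi 0 i4 - t) * normsq (v 0 i2)
   + (xi 0 i2 + xi 0 i3 - t) * normsq (v 0 i3)
   + (xi 0 i2 + xi 0 i4 - t) * normsq (v 0 i4)).
Proof.
move=> n.
have anti (A : M4) i j : A^T = - A -> normsq (A j i) = normsq (A i j).
  by move/matrixP/(_ i j); rewrite !mxE => ->; rewrite normsqN.
have diag0 (A : M4) i : A^T = - A -> normsq (A i i) = 0.
  move/matrixP/(_ i i); rewrite !mxE => /eqP.
  by rewrite -addr_eq0 -mulr2n mulrn_eq0 /= => /eqP->; rewrite normsq0.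
(* Entries (i, j) and (j, i) of an antisymmetric matrix have equal moduli, so their weights Lam_i -
   t/2 and Lam_j - t/2 add up to Lam_i + Lam_j - t. *)
have := @bivector_form (bivec v) (t / 2) (@bivec_offblock v).
set U := h *m bivec v *m h^T.
have UT : U^T = - U.
  by rewrite /U !trmx_mul trmxK tr_bivec mulNmx mulmxN mulmxA.
have UE i j : normsq (U i j) = n i j by rewrite /n -bivec_coefE.
have := tr_bivec v; set Om := bivec v => OT.
have [e13 e14 e23 e24] := bivecE v.
rewrite !sum4 (diag0 U _ UT) (diag0 U i2 UT) (diag0 U i3 UT) (diag0 U i4 UT).
rewrite (anti U i1 i2 UT) (anti U i1 i3 UT) (anti U i1 i4 UT) (anti U i2 i3 UT).
rewrite (anti U i2 i4 UT) (anti U i3 i4 UT) !UE.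
rewrite !(diag0 Om _ OT) (anti Om i1 i2 OT) (anti Om i1 i3 OT) (anti Om i1 i4 OT).
rewrite (anti Om i2 i3 OT) (anti Om i2 i4 OT) (anti Om i3 i4 OT).
rewrite /Om e13 e14 e23 e24 !bivec_offblock // normsq0 /sgnJ /= expr0 expr1.
rewrite -!/(n _ _); move: (n i1 i2) (n i1 i3) (n i1 i4) (n i2 i3) (n i2 i4) (n i3 i4).
move: (normsq (v 0 i1)) (normsq (v 0 i2)) (normsq (v 0 i3)) (normsq (v 0 i4)).
move: (Lam 0 i1) (Lam 0 i2) (Lam 0 i3) (Lam 0 i4).
move: (xi 0 i1) (xi 0 i2) (xi 0 i3) (xi 0 i4).
by move=> *; lra.
Qed.

(** * Sign counts for the forms on vectors and on bivectors *)

Hypothesis chL : holomorphic_chamber Lam.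
Hypothesis ox12 : xi 0 i1 >= xi 0 i2.
Hypothesis ox34 : xi 0 i3 >= xi 0 i4.

Lemma coord_mulmx (v : 'rV[R[i]]_4) k : (v *m (delta_mx k 0 : 'cV_4)) 0 0 = v 0 k.
Proof.
rewrite mxE (bigD1 k) //= big1 ?addr0 => [|l lk]; rewrite mxE ?eqxx ?mulr1 //.
by rewrite (negPf lk) mulr0.
Qed.

Lemma row_neq0 (v : 'rV[R[i]]_4) : v != 0 ->
  0 < normsq (v 0 i1) + normsq (v 0 i2) + normsq (v 0 i3) + normsq (v 0 i4).
Proof.
move=> v0; rewrite -(sum4 (fun i => normsq (v 0 i))) lt0r sumr_ge0 ?andbT => [|i _].
  apply: contra v0; rewrite psumr_eq0 => [/allP z|i _]; last exact: normsq_ge0.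
  apply/eqP/rowP => i; rewrite mxE; apply/eqP; rewrite -normsq_eq0.
  exact: z (mem_index_enum _).
exact: normsq_ge0.
Qed.

Lemma vector_identity (v : 'rV[R[i]]_4) (t : R) :
  (forall i j, v 0 i != 0 -> v 0 j != 0 -> same_block i j) ->
  let n (i : 'I_4) := normsq ((v *m (row i h)^T) 0 0) in
  (Lam 0 i1 - t) * n i1 + (Lam 0 i2 - t) * n i2
  - (Lam 0 i3 - t) * n i3 - (Lam 0 i4 - t) * n i4 =
  (xi 0 i1 - t) * normsq (v 0 i1) + (xi 0 i2 - t) * normsq (v 0 i2)
  - (xi 0 i3 - t) * normsq (v 0 i3) - (xi 0 i4 - t) * normsq (v 0 i4).
Proof.
move=> vb n; have := vector_form t vb; rewrite !sum4 -!/(n _) /sgnJ /= expr0 expr1.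
by rewrite !mul1r !mulN1r !mulNr.
Qed.

Lemma same_block_support (v : 'rV[R[i]]_4) :
  (v 0 i3 = 0 /\ v 0 i4 = 0) \/ (v 0 i1 = 0 /\ v 0 i2 = 0) ->
  forall i j, v 0 i != 0 -> v 0 j != 0 -> same_block i j.
Proof.
have vE (k l : 'I_4) : (k == l :> nat) -> v 0 k = v 0 l.
  by move=> /eqP/val_inj ->.
have bad (a b k : 'I_4) : v 0 a = 0 -> v 0 b = 0 ->
    v 0 k != 0 -> (k != a :> nat) && (k != b :> nat).
  move=> va vb vk; apply/andP; split; apply/negP => /vE kE; move: vk.
    by rewrite kE va eqxx.
  by rewrite kE vb eqxx.
move=> [[a0 b0]|[a0 b0]] i j /(bad _ _ _ a0 b0) + /(bad _ _ _ a0 b0);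
  by case: i j => [[|[|[|[|//]]]] ?] [[|[|[|[|//]]]] ?].
Qed.

(** The conditions [a] and [b] confine a vector to one block and [c] is a third one, to be chosen;
    [n] and [m] are the squared moduli of its coordinates in the basis given by g and in the
    standard one. The vector does not depend on t. *)
Lemma vector_witness (a b c : 'cV[R[i]]_4) (p q : 'I_4) :
  (p, q) \in [:: (i3, i4); (i1, i2)] -> a = delta_mx p 0 -> b = delta_mx q 0 ->
  exists n m : 'I_4 -> R,
  [/\ (forall i, 0 <= n i) /\ (forall i, 0 <= m i),
    forall k, c = (row k h)^T -> n k = 0,
    forall k, [\/ a = delta_mx k 0, b = delta_mx k 0 | c = delta_mx k 0] -> m k = 0,
    0 < m i1 + m i2 + m i3 + m i4
  & forall t, (Lam 0 i1 - t) * n i1 + (Lam 0 i2 - t) * n i2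
    - (Lam 0 i3 - t) * n i3 - (Lam 0 i4 - t) * n i4 =
    (xi 0 i1 - t) * m i1 + (xi 0 i2 - t) * m i2
    - (xi 0 i3 - t) * m i3 - (xi 0 i4 - t) * m i4].
Proof.
move=> pq ea eb; have [v [v0 va vb vc]] := exists_common_zero a b c.
exists (fun k => normsq ((v *m (row k h)^T) 0 0)), (fun k => normsq (v 0 k)).
split.
- by split=> ?; exact: normsq_ge0.
- by move=> k ck; rewrite -ck vc normsq0.
- by move=> k abc; rewrite -coord_mulmx; case: abc => <-; rewrite ?va ?vb ?vc normsq0.
- exact: row_neq0.
move=> t; apply: vector_identity; apply: same_block_support.
move: va vb; rewrite ea eb !coord_mulmx => vp vq.
by move: pq; rewrite !inE !xpair_eqE => /orP[] /andP[/eqP <- /eqP <-]; [left|right].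
Qed.

(** Mixed bivectors form a space of dimension four, so here all three conditions can be chosen,
    among the coordinates in either basis. *)
Lemma bivector_witness (a b c : 'cV[R[i]]_4) :
  exists (n : 'I_4 -> 'I_4 -> R) (m : 'I_4 -> R),
  [/\ (forall i j, 0 <= n i j) /\ (forall i, 0 <= m i),
    forall i j, [\/ a = bivec_coef i j, b = bivec_coef i j | c = bivec_coef i j] ->
      n i j = 0,
    forall k, [\/ a = delta_mx k 0, b = delta_mx k 0 | c = delta_mx k 0] -> m k = 0,
    0 < m i1 + m i2 + m i3 + m i4
  & forall t,
    (Lam 0 i1 + Lam 0 i2 - t) * n i1 i2 + (Lam 0 i3 + Lam 0 i4 - t) * n i3 i4
    - (Lam 0 i1 + Lam 0 i3 - t) * n i1 i3 - (Lam 0 i1 + Lam 0 i4 - t) * n i1 i4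
    - (Lam 0 i2 + Lam 0 i3 - t) * n i2 i3 - (Lam 0 i2 + Lam 0 i4 - t) * n i2 i4 =
    - ((xi 0 i1 + xi 0 i3 - t) * m i1 + (xi 0 i1 + xi 0 i4 - t) * m i2
     + (xi 0 i2 + xi 0 i3 - t) * m i3 + (xi 0 i2 + xi 0 i4 - t) * m i4)].
Proof.
have [v [v0 va vb vc]] := exists_common_zero a b c.
exists (fun i j => normsq ((v *m bivec_coef i j) 0 0)), (fun k => normsq (v 0 k)).
split.
- by split=> *; exact: normsq_ge0.
- by move=> i j abc; case: abc => <-; rewrite ?va ?vb ?vc normsq0.
- by move=> k abc; rewrite -coord_mulmx; case: abc => <-; rewrite ?va ?vb ?vc normsq0.
- exact: row_neq0.
exact: bivec_identity.
Qed.

Lemma eigenvalue_bounds :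
  [/\ xi 0 i1 >= Lam 0 i1, xi 0 i2 >= Lam 0 i2, xi 0 i3 <= Lam 0 i3
    & xi 0 i4 <= Lam 0 i4].
Proof.
have [_ L12 L23 L34] := chL; split; rewrite -subr_ge0.
(* Take v in the first block with second g-coordinate zero. At t = Lam_1 the left side of [E] is
   nonnegative, and the right side is at most (xi_1 - Lam_1)(m_1 + m_2) because xi_2 <= xi_1. The
   other bounds are similar; for xi_2 and xi_3, v is a multiple of a basis vector. *)
- have [n [m [[n0 m0] nc mc mp /(_ (Lam 0 i1)) E]]] :=
    @vector_witness (delta_mx i3 0) (delta_mx i4 0) (row i2 h)^T i3 i4 isT erefl erefl.
  rewrite -(pmulr_lge0 _ mp).
  move: E (n0 i3) (n0 i4) (m0 i2).
  rewrite (nc i2) // (mc i3) ?(mc i4); try by constructor.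
  move: (n i1) (n i3) (n i4) (m i1) (m i2) (Lam 0 i1) (Lam 0 i2) (Lam 0 i3) (Lam 0 i4)
    (xi 0 i1) (xi 0 i2) (xi 0 i3) (xi 0 i4) L12 L23 L34 ox12 ox34.
  move=> n1 n3 n4 m1 m2 L1 L2 L3 L4 x1 x2 x3 x4 *; nra.
- have [n [m [[n0 m0] nc mc mp /(_ (Lam 0 i2)) E]]] :=
    @vector_witness (delta_mx i3 0) (delta_mx i4 0) (delta_mx i1 0) i3 i4 isT erefl erefl.
  rewrite -(pmulr_lge0 _ mp).
  move: E (n0 i1) (n0 i3) (n0 i4) (m0 i2).
  rewrite (mc i1) ?(mc i3) ?(mc i4); try by constructor.
  move: (n i1) (n i2) (n i3) (n i4) (m i1) (m i2) (Lam 0 i1) (Lam 0 i2) (Lam 0 i3) (Lam 0 i4)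
    (xi 0 i1) (xi 0 i2) (xi 0 i3) (xi 0 i4) L12 L23 L34 ox12 ox34.
  move=> n1 n2 n3 n4 m1 m2 L1 L2 L3 L4 x1 x2 x3 x4 *; nra.
- have [n [m [[n0 m0] nc mc mp /(_ (Lam 0 i3)) E]]] :=
    @vector_witness (delta_mx i1 0) (delta_mx i2 0) (delta_mx i4 0) i1 i2 isT erefl erefl.
  rewrite -(pmulr_lge0 _ mp).
  move: E (n0 i1) (n0 i2) (n0 i4) (m0 i3).
  rewrite (mc i1) ?(mc i2) ?(mc i4); try by constructor.
  move: (n i1) (n i2) (n i3) (n i4) (m i1) (m i3) (Lam 0 i1) (Lam 0 i2) (Lam 0 i3) (Lam 0 i4)
    (xi 0 i1) (xi 0 i2) (xi 0 i3) (xi 0 i4) L12 L23 L34 ox12 ox34.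
  move=> n1 n2 n3 n4 m1 m2 L1 L2 L3 L4 x1 x2 x3 x4 *; nra.
- have [n [m [[n0 m0] nc mc mp /(_ (Lam 0 i4)) E]]] :=
    @vector_witness (delta_mx i1 0) (delta_mx i2 0) (row i3 h)^T i1 i2 isT erefl erefl.
  rewrite -(pmulr_lge0 _ mp).
  move: E (n0 i1) (n0 i2) (m0 i3).
  rewrite (nc i3) // (mc i1) ?(mc i2); try by constructor.
  move: (n i1) (n i2) (n i4) (m i3) (m i4) (Lam 0 i1) (Lam 0 i2) (Lam 0 i3) (Lam 0 i4)
    (xi 0 i1) (xi 0 i2) (xi 0 i3) (xi 0 i4) L12 L23 L34 ox12 ox34.
  move=> n1 n3 n4 m1 m2 L1 L2 L3 L4 x1 x2 x3 x4 *; nra.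
Qed.

(** At the chosen t the conditions leave terms of one sign on the Lam side. The upper bounds use
    bivectors in the plane of e_1 /\ e_3, e_1 /\ e_4 or of e_1 /\ e_3, e_2 /\ e_3, with one
    condition on the Lam side. The lower bounds use all mixed bivectors, xi_1 + xi_3 being the
    largest mixed sum, with three conditions on the Lam side. *)
Lemma eigenvalue_sum_bounds :
  [/\ xi 0 i1 + xi 0 i4 <= Lam 0 i1 + Lam 0 i3,
    xi 0 i2 + xi 0 i3 <= Lam 0 i1 + Lam 0 i3,
    xi 0 i1 + xi 0 i3 >= Lam 0 i1 + Lam 0 i4
  & xi 0 i1 + xi 0 i3 >= Lam 0 i2 + Lam 0 i3].
Proof.
have [_ L12 L23 L34] := chL; split; rewrite -subr_ge0.
- have [n [m [[n0 m0] nc mc mp /(_ (Lam 0 i1 + Lam 0 i3)) E]]] :=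
    bivector_witness (bivec_coef i3 i4) (delta_mx i3 0) (delta_mx i4 0).
  rewrite -(pmulr_lge0 _ mp).
  move: E (n0 i1 i2) (n0 i1 i3) (n0 i1 i4) (n0 i2 i3) (n0 i2 i4) (m0 i1) (m0 i2).
  rewrite ?(nc i3 i4) ?(mc i3) ?(mc i4); try by constructor.
  move: (n i1 i2) (n i1 i3) (n i1 i4) (n i2 i3) (n i2 i4) (m i1) (m i2).
  move: (Lam 0 i1) (Lam 0 i2) (Lam 0 i3) (Lam 0 i4)
    (xi 0 i1) (xi 0 i2) (xi 0 i3) (xi 0 i4) L12 L23 L34 ox12 ox34.
  move=> L1 L2 L3 L4 x1 x2 x3 x4 L12' L23' L34' o12 o34 y0 y1 y2 y3 y4 y5 y6 *; nra.
- have [n [m [[n0 m0] nc mc mp /(_ (Lam 0 i1 + Lam 0 i3)) E]]] :=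
    bivector_witness (bivec_coef i3 i4) (delta_mx i2 0) (delta_mx i4 0).
  rewrite -(pmulr_lge0 _ mp).
  move: E (n0 i1 i2) (n0 i1 i3) (n0 i1 i4) (n0 i2 i3) (n0 i2 i4) (m0 i1) (m0 i3).
  rewrite ?(nc i3 i4) ?(mc i2) ?(mc i4); try by constructor.
  move: (n i1 i2) (n i1 i3) (n i1 i4) (n i2 i3) (n i2 i4) (m i1) (m i3).
  move: (Lam 0 i1) (Lam 0 i2) (Lam 0 i3) (Lam 0 i4)
    (xi 0 i1) (xi 0 i2) (xi 0 i3) (xi 0 i4) L12 L23 L34 ox12 ox34.
  move=> L1 L2 L3 L4 x1 x2 x3 x4 L12' L23' L34' o12 o34 y0 y1 y2 y3 y4 y5 y6 *; nra.
- have [n [m [[n0 m0] nc mc mp /(_ (Lam 0 i1 + Lam 0 i4)) E]]] :=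
    bivector_witness (bivec_coef i1 i2) (bivec_coef i2 i4) (bivec_coef i2 i3).
  rewrite -(pmulr_lge0 _ mp).
  move: E (n0 i3 i4) (n0 i1 i3) (n0 i1 i4) (m0 i1) (m0 i2) (m0 i3) (m0 i4).
  rewrite ?(nc i1 i2) ?(nc i2 i4) ?(nc i2 i3) ; try by constructor.
  move: (n i3 i4) (n i1 i3) (n i1 i4) (m i1) (m i2) (m i3) (m i4).
  move: (Lam 0 i1) (Lam 0 i2) (Lam 0 i3) (Lam 0 i4)
    (xi 0 i1) (xi 0 i2) (xi 0 i3) (xi 0 i4) L12 L23 L34 ox12 ox34.
  move=> L1 L2 L3 L4 x1 x2 x3 x4 L12' L23' L34' o12 o34 y0 y1 y2 y3 y4 y5 y6 *; nra.
- have [n [m [[n0 m0] nc mc mp /(_ (Lam 0 i2 + Lam 0 i3)) E]]] :=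
    bivector_witness (bivec_coef i1 i2) (bivec_coef i2 i4) (bivec_coef i1 i4).
  rewrite -(pmulr_lge0 _ mp).
  move: E (n0 i3 i4) (n0 i1 i3) (n0 i2 i3) (m0 i1) (m0 i2) (m0 i3) (m0 i4).
  rewrite ?(nc i1 i2) ?(nc i2 i4) ?(nc i1 i4) ; try by constructor.
  move: (n i3 i4) (n i1 i3) (n i2 i3) (m i1) (m i2) (m i3) (m i4).
  move: (Lam 0 i1) (Lam 0 i2) (Lam 0 i3) (Lam 0 i4)
    (xi 0 i1) (xi 0 i2) (xi 0 i3) (xi 0 i4) L12 L23 L34 ox12 ox34.
  move=> L1 L2 L3 L4 x1 x2 x3 x4 L12' L23' L34' o12 o34 y0 y1 y2 y3 y4 y5 y6 *; nra.
Qed.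

End Group.
End Necessity.

(** * Block projections from Cartan parameters *)

Section Construction.
Variable R : realType.
Local Notation M4 := 'M[R[i]]_4.

(** Half-angle formulas: they write a symmetric 2 x 2 matrix with eigenvalue gap A and trace-free
    part (X/2, Y/2) as a rotated diagonal matrix. *)
Lemma half_angle (X Y A : R) : 0 <= A -> X ^+ 2 + Y ^+ 2 = A ^+ 2 ->
  exists c s : R, [/\ c ^+ 2 + s ^+ 2 = 1, A * (c ^+ 2 - s ^+ 2) = X & 2 * A * c * s = Y].
Proof.
move=> A0 XY.
have [A1|A1] := eqVneq A 0.
  exists 1, 0; move: XY; rewrite A1 expr0n /= => /eqP.
  rewrite paddr_eq0 ?sqr_ge0 // !sqrf_eq0 => /andP[/eqP-> /eqP->].
  by split; ring.
have Ap : 0 < A by rewrite lt0r A1.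
(* In this case the general formula would give c = 0, and s could not be obtained as Y / (2 A c). *)
have [AX|AX] := eqVneq (A + X) 0.
  have XA : X = - A by lra.
  have Y0 : Y = 0 by apply/eqP; rewrite -sqrf_eq0; apply/eqP; move: XY; rewrite XA; lra.
  by exists 0, 1; rewrite XA Y0; split; ring.
have AXp : 0 < A + X.
  have X2 : X ^+ 2 <= A ^+ 2 by rewrite -XY lerDl sqr_ge0.
  by rewrite lt0r AX /= leNgt; apply/negP => h; nra.
pose c := Num.sqrt ((A + X) / (2 * A)).
have c2 : c ^+ 2 = (A + X) / (2 * A).
  by rewrite sqr_sqrtr // divr_ge0 // ?mulr_ge0 // ltW.
have c0 : c != 0 by rewrite -sqrf_eq0 c2 mulf_neq0 ?invr_eq0 ?mulf_neq0 ?pnatr_eq0.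
have s2 : (Y / (2 * A * c)) ^+ 2 = (A - X) / (2 * A).
  rewrite exprMn exprVn !exprMn c2.
  have -> : Y ^+ 2 = (A - X) * (A + X) by rewrite -subr_sqr -XY; ring.
  by field; rewrite A1 AX.
exists c, (Y / (2 * A * c)); split.
- by rewrite c2 s2; field; exact: A1.
- by rewrite c2 s2; field; exact: A1.
- by field; rewrite c0.
Qed.

(** * Real block rotations and commuting boosts as literal matrices *)

Definition mx4 (rows : seq (seq R)) : 'M[R]_4 :=
  \matrix_(i, j) nth 0 (nth [::] rows i) j.

Definition Jr : 'M[R]_4 := mx4
  [:: [:: 1; 0; 0; 0]; [:: 0; 1; 0; 0]; [:: 0; 0; -1; 0]; [:: 0; 0; 0; -1]].

Definition rotations (c s c' s' : R) := mx4
  [:: [:: c; - s; 0; 0]; [:: s; c; 0; 0]; [:: 0; 0; c'; - s']; [:: 0; 0; s'; c']].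

Definition boosts (c1 s1 c2 s2 : R) := mx4
  [:: [:: c1; 0; s1; 0]; [:: 0; c2; 0; s2]; [:: s1; 0; c1; 0]; [:: 0; s2; 0; c2]].

Definition rdiag4 (c : 'rV[R]_4) := mx4
  [:: [:: c 0 i1; 0; 0; 0]; [:: 0; c 0 i2; 0; 0]; [:: 0; 0; c 0 i3; 0]; [:: 0; 0; 0; c 0 i4]].

Definition sym_blocks (p q z r u w : R) := mx4
  [:: [:: p; z; 0; 0]; [:: z; q; 0; 0]; [:: 0; 0; r; w]; [:: 0; 0; w; u]].

Lemma mx4_ext (A B : 'M[R]_4) :
  (forall i j, i \in [:: i1; i2; i3; i4] -> j \in [:: i1; i2; i3; i4] -> A i j = B i j) ->
  A = B.
Proof.
move=> h; apply/matrixP => i j; apply: h.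
  by case: i => [[|[|[|[|//]]]] ?]; rewrite !inE.
by case: j => [[|[|[|[|//]]]] ?]; rewrite !inE.
Qed.

Lemma mx4M (A B : seq (seq R)) (i j : 'I_4) :
  (mx4 A *m mx4 B) i j = 
  nth 0 (nth [::] A i) 0 * nth 0 (nth [::] B 0) j +
  nth 0 (nth [::] A i) 1 * nth 0 (nth [::] B 1) j +
  nth 0 (nth [::] A i) 2 * nth 0 (nth [::] B 2) j +
  nth 0 (nth [::] A i) 3 * nth 0 (nth [::] B 3) j.
Proof. by rewrite mxE sum4 !mxE. Qed.

Lemma rotations_tr c s c' s' :
  (rotations c s c' s')^T = rotations c (- s) c' (- s').
Proof.
by apply: mx4_ext => i j; rewrite !inE => /or4P[] /eqP -> /or4P[] /eqP ->;
  rewrite !mxE /= ?opprK.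
Qed.

Lemma rotations_orthogonal c s c' s' : c ^+ 2 + s ^+ 2 = 1 -> c' ^+ 2 + s' ^+ 2 = 1 ->
  (rotations c s c' s')^T *m rotations c s c' s' = 1%:M.
Proof.
move=> cs cs'.
rewrite rotations_tr.
apply: mx4_ext => i j; rewrite !inE => /or4P[] /eqP -> /or4P[] /eqP ->;
  rewrite mx4M !mxE /= ?mulr1n ?mulr0n; lra.
Qed.


Lemma boosts_tr c1 s1 c2 s2 : (boosts c1 s1 c2 s2)^T = boosts c1 s1 c2 s2.
Proof.
by apply: mx4_ext => i j; rewrite !inE => /or4P[] /eqP -> /or4P[] /eqP ->;
  rewrite !mxE /=.
Qed.

Lemma rotations_isometry c s c' s' : c ^+ 2 + s ^+ 2 = 1 -> c' ^+ 2 + s' ^+ 2 = 1 ->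
  (rotations c s c' s')^T *m Jr *m rotations c s c' s' = Jr.
Proof.
move=> cs cs'.
have -> : (rotations c s c' s')^T *m Jr = Jr *m (rotations c s c' s')^T.
  rewrite rotations_tr; apply: mx4_ext => i j; rewrite !inE => /or4P[] /eqP -> /or4P[] /eqP ->;
  by rewrite !mx4M /=; ring.
by rewrite -mulmxA rotations_orthogonal // mulmx1.
Qed.

Lemma boosts_isometry c1 s1 c2 s2 :
  c1 ^+ 2 - s1 ^+ 2 = 1 -> c2 ^+ 2 - s2 ^+ 2 = 1 ->
  (boosts c1 s1 c2 s2)^T *m Jr *m boosts c1 s1 c2 s2 = Jr.
Proof.
move=> h1 h2; rewrite boosts_tr.
have -> : boosts c1 s1 c2 s2 *m Jr = mx4 [:: [:: c1; 0; - s1; 0];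
    [:: 0; c2; 0; - s2]; [:: s1; 0; - c1; 0]; [:: 0; s2; 0; - c2]].
  apply: mx4_ext => i j; rewrite !inE => /or4P[] /eqP -> /or4P[] /eqP ->;
  by rewrite mx4M !mxE /=; ring.
apply: mx4_ext => i j; rewrite !inE => /or4P[] /eqP -> /or4P[] /eqP ->;
  by rewrite mx4M !mxE /=; lra.
Qed.

Lemma boostsV c1 s1 c2 s2 :
  c1 ^+ 2 - s1 ^+ 2 = 1 -> c2 ^+ 2 - s2 ^+ 2 = 1 ->
  boosts c1 (- s1) c2 (- s2) *m boosts c1 s1 c2 s2 = 1%:M.
Proof.
move=> h1 h2.
apply: mx4_ext => i j; rewrite !inE => /or4P[] /eqP -> /or4P[] /eqP ->;
  by rewrite mx4M !mxE /= ?mulr1n ?mulr0n; lra.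
Qed.

Lemma conj_rotations (Lam : 'rV[R]_4) c s c' s' :
  rotations c s c' s' *m rdiag4 Lam *m (rotations c s c' s')^T =
  sym_blocks (c ^+ 2 * Lam 0 i1 + s ^+ 2 * Lam 0 i2)
    (s ^+ 2 * Lam 0 i1 + c ^+ 2 * Lam 0 i2) ((Lam 0 i1 - Lam 0 i2) * c * s)
    (c' ^+ 2 * Lam 0 i3 + s' ^+ 2 * Lam 0 i4)
    (s' ^+ 2 * Lam 0 i3 + c' ^+ 2 * Lam 0 i4) ((Lam 0 i3 - Lam 0 i4) * c' * s').
Proof.
rewrite rotations_tr /rdiag4.
move: (Lam 0 i1) (Lam 0 i2) (Lam 0 i3) (Lam 0 i4) => L1 L2 L3 L4.
have -> : rotations c s c' s' *m mx4 [:: [:: L1; 0; 0; 0]; [:: 0; L2; 0; 0];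
    [:: 0; 0; L3; 0]; [:: 0; 0; 0; L4]] =
  mx4 [:: [:: c * L1; - s * L2; 0; 0]; [:: s * L1; c * L2; 0; 0];
    [:: 0; 0; c' * L3; - s' * L4]; [:: 0; 0; s' * L3; c' * L4]].
  apply: mx4_ext => i j; rewrite !inE => /or4P[] /eqP -> /or4P[] /eqP ->;
  by rewrite mx4M !mxE /=; ring.
apply: mx4_ext => i j; rewrite !inE => /or4P[] /eqP -> /or4P[] /eqP ->;
  by rewrite mx4M !mxE /=; ring.
Qed.

Lemma conj_boosts c1 s1 c2 s2 p q z r u w :
  let X := boosts c1 s1 c2 s2 *m sym_blocks p q z r u w *m boosts c1 (- s1) c2 (- s2) in
  [/\ X i1 i1 = c1 ^+ 2 * p - s1 ^+ 2 * r, X i2 i2 = c2 ^+ 2 * q - s2 ^+ 2 * u,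
    X i1 i2 = c1 * c2 * z - s1 * s2 * w & X i2 i1 = c1 * c2 * z - s1 * s2 * w] /\
  [/\ X i3 i3 = c1 ^+ 2 * r - s1 ^+ 2 * p, X i4 i4 = c2 ^+ 2 * u - s2 ^+ 2 * q,
    X i3 i4 = c1 * c2 * w - s1 * s2 * z & X i4 i3 = c1 * c2 * w - s1 * s2 * z].
Proof.
move=> X; rewrite /X.
have -> : boosts c1 s1 c2 s2 *m sym_blocks p q z r u w =
  mx4 [:: [:: c1 * p; c1 * z; s1 * r; s1 * w]; [:: c2 * z; c2 * q; s2 * w; s2 * u];
    [:: s1 * p; s1 * z; c1 * r; c1 * w]; [:: s2 * z; s2 * q; c2 * w; c2 * u]].
  apply: mx4_ext => i j; rewrite !inE => /or4P[] /eqP -> /or4P[] /eqP ->;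
  by rewrite mx4M !mxE /=; ring.
by do !split; rewrite mx4M /=; ring.
Qed.

Lemma conj_rotations_block (X : 'M[R]_4) c s c' s' (i j : 'I_4) : same_block i j ->
  (rotations c s c' s' *m X *m (rotations c s c' s')^T) i j =
  if (i < 2)%N then
    (rotations c s c' s' i i1 * X i1 i1 + rotations c s c' s' i i2 * X i2 i1) *
      rotations c s c' s' j i1 +
    (rotations c s c' s' i i1 * X i1 i2 + rotations c s c' s' i i2 * X i2 i2) *
      rotations c s c' s' j i2
  else
    (rotations c s c' s' i i3 * X i3 i3 + rotations c s c' s' i i4 * X i4 i3) *
      rotations c s c' s' j i3 +
    (rotations c s c' s' i i3 * X i3 i4 + rotations c s c' s' i i4 * X i4 i4) *
      rotations c s c' s' j i4.
Proof.
have iP (k : 'I_4) : k \in [:: i1; i2; i3; i4].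
  by case: k => [[|[|[|[|//]]]] ?]; rewrite !inE.
move: (iP i) (iP j); rewrite !inE => /or4P[] /eqP -> /or4P[] /eqP -> //= _;
  rewrite mxE sum4 [(_ *m X) _ i1]mxE [(_ *m X) _ i2]mxE [(_ *m X) _ i3]mxE
   [(_ *m X) _ i4]mxE !sum4 !mxE /=; ring.
Qed.

(* Right multiplication by this matrix, for d = 1 or -1, corrects the determinant
   of g without changing g diag(Lam) g^-1. *)
Definition axis_scaling (d : R) := mx4
  [:: [:: d; 0; 0; 0]; [:: 0; 1; 0; 0]; [:: 0; 0; 1; 0]; [:: 0; 0; 0; 1]].

Lemma axis_scalingP (d : R) : d * d = 1 -> let E := axis_scaling d in
  [/\ E^T *m Jr *m E = Jr, E *m E = 1%:M, \det E = d
    & forall c, E *m rdiag4 c *m E = rdiag4 c].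
Proof.
move=> dd E.
have ET : E^T = E.
  by apply: mx4_ext => i j; rewrite !inE => /or4P[] /eqP -> /or4P[] /eqP ->;
    rewrite !mxE.
have EE : E *m E = 1%:M.
  by apply: mx4_ext => i j; rewrite !inE => /or4P[] /eqP -> /or4P[] /eqP ->;
    rewrite mx4M !mxE /= ?mulr1n ?mulr0n ?dd; ring.
have EC rows a b c e : rows = [:: [:: a; 0; 0; 0]; [:: 0; b; 0; 0]; [:: 0; 0; c; 0];
    [:: 0; 0; 0; e]] -> E *m mx4 rows *m E = mx4 rows.
  move=> ->; have -> : E *m mx4 [:: [:: a; 0; 0; 0]; [:: 0; b; 0; 0]; [:: 0; 0; c; 0];
      [:: 0; 0; 0; e]] = mx4 [:: [:: a; 0; 0; 0]; [:: 0; b; 0; 0]; [:: 0; 0; c; 0];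
      [:: 0; 0; 0; e]] *m E.
    apply: mx4_ext => i j; rewrite !inE => /or4P[] /eqP -> /or4P[] /eqP ->;
    by rewrite !mx4M /=; ring.
  by rewrite -mulmxA EE mulmx1.
split=> //.
- by rewrite ET /Jr; apply: EC.
- have -> : E = diag_mx (\row_i if i == i1 then d else 1).
    by apply: mx4_ext => i j; rewrite !inE => /or4P[] /eqP -> /or4P[] /eqP ->;
      rewrite !mxE /= ?mulr1n ?mulr0n.
  rewrite det_diag (bigD1 i1) //= big1 ?mulr1 ?mxE // => i /negPf ni.
  by rewrite mxE ni.
- by move=> c; apply: EC.
Qed.

(** Complexifies a real isometry of [Jr]. Its determinant d satisfies d^2 = 1, and [axis_scaling d]
    corrects it to 1. *)
Lemma block_reachable_real (Lam xi : 'rV[R]_4) (g g' : 'M[R]_4) :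
  g^T *m Jr *m g = Jr -> g' *m g = 1%:M ->
  (forall i j, same_block i j -> (g *m rdiag4 Lam *m g') i j = rdiag4 xi i j) ->
  block_reachable Lam xi.
Proof.
move=> gJ gV hg.
pose f (A : 'M[R]_4) : M4 := map_mx (real_complex R) A.
have fM A B : f (A *m B) = f A *m f B by exact: map_mxM.
have fJ : f Jr = J22 R.
  apply/matrixP => i j; rewrite !mxE.
  case: i j => [[|[|[|[|//]]]] ?] [[|[|[|[|//]]]] ?] //=;
  by rewrite ?expr0 ?expr1 ?rmorphN ?rmorph1 ?rmorph0.
have fD c : f (rdiag4 c) = rdiag c.
  apply/matrixP => i j; rewrite rdiagE !mxE.
  case: i j => [[|[|[|[|//]]]] ?] [[|[|[|[|//]]]] ?] //=;
  by congr ((c 0 _)%:C%C); apply: val_inj.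
have fC A : (f A) ^t* = f A^T.
  by apply/matrixP => i j; rewrite !mxE; exact: conjc_real.
pose d := \det g.
have dd : d * d = 1.
  have J2 : \det Jr * \det Jr = 1.
    rewrite -det_mulmx (_ : Jr *m Jr = 1%:M) ?det1 //.
    by apply: mx4_ext => i j; rewrite !inE => /or4P[] /eqP -> /or4P[] /eqP ->;
      rewrite mx4M !mxE /= ?mulr1n ?mulr0n; ring.
  have := congr1 determinant gJ; rewrite !det_mulmx det_tr -/d => e.
  rewrite -[LHS]mulr1 -[in LHS]J2.
  by transitivity (d * \det Jr * d * \det Jr); [ring | rewrite e].
have [EJ EE Ed EC] := axis_scalingP dd; set E := axis_scaling d in EJ EE Ed EC.
have hV : E *m g' *m (g *m E) = 1%:M.
  by rewrite -mulmxA (mulmxA g') gV mul1mx EE.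
have fV : invmx (f (g *m E)) = f (E *m g').
  have h1 : f (E *m g') *m f (g *m E) = 1%:M by rewrite -fM hV; exact: map_mx1.
  have [_ u] := mulmx1_unit h1.
  by rewrite -[LHS]mul1mx -h1 mulmxK.
exists (f (g *m E)).
  split; last by rewrite det_map_mx det_mulmx Ed dd rmorph1.
  by rewrite fC -fJ -!fM trmx_mul -!mulmxA (mulmxA Jr) (mulmxA _ _ E) (mulmxA g^T) gJ mulmxA EJ.
move=> i j sij; rewrite fV -fD -!fM.
have -> : g *m E *m rdiag4 Lam *m (E *m g') = g *m rdiag4 Lam *m g'.
  by rewrite -[in RHS](EC Lam) !mulmxA.
by rewrite mxE hg // -fD [in RHS]mxE.
Qed.

(* The parameters are those of g = k' exp(p) k with k, k' block rotations and
   exp(p) a product of two commuting boosts; the two blocks of k.Lam have trace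
   free parts (P, z) and (Q, w). *)
Lemma block_reachable_params (Lam xi : 'rV[R]_4) (P Q z w c1 s1 c2 s2 : R) :
  normalized Lam -> normalized xi ->
  Lam 0 i2 <= Lam 0 i1 -> Lam 0 i4 <= Lam 0 i3 ->
  xi 0 i2 <= xi 0 i1 -> xi 0 i4 <= xi 0 i3 ->
  P ^+ 2 + z ^+ 2 = (Lam 0 i1 - Lam 0 i2) ^+ 2 ->
  Q ^+ 2 + w ^+ 2 = (Lam 0 i3 - Lam 0 i4) ^+ 2 ->
  c1 ^+ 2 - s1 ^+ 2 = 1 -> c2 ^+ 2 - s2 ^+ 2 = 1 ->
  let L := Lam 0 i1 + Lam 0 i2 in
  let x := s1 ^+ 2 * (2 * L + P - Q) in let y := s2 ^+ 2 * (2 * L - P + Q) in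
  x + y = 2 * (xi 0 i1 + xi 0 i2 - L) ->
  (P + (x - y) / 2) ^+ 2 + (c1 * c2 * z - s1 * s2 * w) ^+ 2 =
    (xi 0 i1 - xi 0 i2) ^+ 2 ->
  (Q - (x - y) / 2) ^+ 2 + (c1 * c2 * w - s1 * s2 * z) ^+ 2 =
    (xi 0 i3 - xi 0 i4) ^+ 2 ->
  block_reachable Lam xi.
Proof.
move=> nL nx oL12 oL34 ox12 ox34 PA QB h1 h2 L x y xy Ea Eb.
move: nL nx; rewrite /normalized !sum4 => nL nx.
have A0 : 0 <= Lam 0 i1 - Lam 0 i2 by lra.
have B0 : 0 <= Lam 0 i3 - Lam 0 i4 by lra.
have a0 : 0 <= xi 0 i1 - xi 0 i2 by lra.
have b0 : 0 <= xi 0 i3 - xi 0 i4 by lra.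
have [c [s [cs Ecs Esc]]] := half_angle A0 PA.
have [c' [s' [cs' Ecs' Esc']]] := half_angle B0 QB.
have [e [t [et Eet Ete]]] := half_angle a0 Ea.
have [e' [t' [et' Eet' Ete']]] := half_angle b0 Eb.
have nt : e ^+ 2 + (- t) ^+ 2 = 1 by rewrite sqrrN.
have nt' : e' ^+ 2 + (- t') ^+ 2 = 1 by rewrite sqrrN.
(* [K2] gives the blocks of diag(Lam) the trace-free parts (P, z)/2 and (Q, w)/2. [K1] carries -t
   and -t' because it diagonalizes the blocks obtained after the boosts. *)
pose K2 := rotations c s c' s'; pose K1 := rotations e (- t) e' (- t').
pose H := boosts c1 s1 c2 s2; pose H' := boosts c1 (- s1) c2 (- s2).
apply: (@block_reachable_real _ _ (K1 *m H *m K2) (K2^T *m H' *m K1^T)).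
- rewrite !trmx_mul -!mulmxA (mulmxA Jr) (mulmxA _ _ (H *m K2)) (mulmxA K1^T).
  rewrite rotations_isometry // (mulmxA Jr) (mulmxA H^T) (mulmxA H^T) boosts_isometry //.
  by rewrite mulmxA rotations_isometry.
- rewrite -!mulmxA (mulmxA K1^T) rotations_orthogonal // mul1mx.
  by rewrite (mulmxA H') boostsV // mul1mx rotations_orthogonal.
move=> i j sij.
have -> : K1 *m H *m K2 *m rdiag4 Lam *m (K2^T *m H' *m K1^T) =
    K1 *m (H *m (K2 *m rdiag4 Lam *m K2^T) *m H') *m K1^T by rewrite !mulmxA.
rewrite conj_rotations_block // conj_rotations.
have [[-> -> -> ->] [-> -> -> ->]] := conj_boosts c1 s1 c2 s2
  (c ^+ 2 * Lam 0 i1 + s ^+ 2 * Lam 0 i2)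
    (s ^+ 2 * Lam 0 i1 + c ^+ 2 * Lam 0 i2) ((Lam 0 i1 - Lam 0 i2) * c * s)
    (c' ^+ 2 * Lam 0 i3 + s' ^+ 2 * Lam 0 i4)
    (s' ^+ 2 * Lam 0 i3 + c' ^+ 2 * Lam 0 i4) ((Lam 0 i3 - Lam 0 i4) * c' * s').
(* As Lam is normalized, the blocks have traces L and -L. The boosts then raise the first two
   diagonal entries by x/2 and y/2 and lower the last two by the same amounts. *)
have pE : c ^+ 2 * Lam 0 i1 + s ^+ 2 * Lam 0 i2 = (L + P) / 2.
  have -> : L + P = L * (c ^+ 2 + s ^+ 2) + P by rewrite cs mulr1.
  by rewrite -Ecs /L; field.
have qE : s ^+ 2 * Lam 0 i1 + c ^+ 2 * Lam 0 i2 = (L - P) / 2.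
  have -> : L - P = L * (c ^+ 2 + s ^+ 2) - P by rewrite cs mulr1.
  by rewrite -Ecs /L; field.
have rE : c' ^+ 2 * Lam 0 i3 + s' ^+ 2 * Lam 0 i4 = (Q - L) / 2.
  have -> : Q - L = (Lam 0 i3 + Lam 0 i4) * (c' ^+ 2 + s' ^+ 2) + Q.
    by rewrite cs' /L; lra.
  by rewrite -Ecs'; field.
have uE : s' ^+ 2 * Lam 0 i3 + c' ^+ 2 * Lam 0 i4 = (- Q - L) / 2.
  have -> : - Q - L = (Lam 0 i3 + Lam 0 i4) * (c' ^+ 2 + s' ^+ 2) - Q.
    by rewrite cs' /L; lra.
  by rewrite -Ecs'; field.
rewrite pE qE rE uE.
have -> : (Lam 0 i1 - Lam 0 i2) * c * s = z / 2 by rewrite -Esc; field.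
have -> : (Lam 0 i3 - Lam 0 i4) * c' * s' = w / 2 by rewrite -Esc'; field.
have c1E : c1 ^+ 2 = 1 + s1 ^+ 2 by lra.
have c2E : c2 ^+ 2 = 1 + s2 ^+ 2 by lra.
have eE : e ^+ 2 = 1 - t ^+ 2 by lra.
have eE' : e' ^+ 2 = 1 - t' ^+ 2 by lra.
have -> : c1 ^+ 2 * ((L + P) / 2) - s1 ^+ 2 * ((Q - L) / 2) =
    ((xi 0 i1 + xi 0 i2) * (e ^+ 2 + t ^+ 2)
     + (xi 0 i1 - xi 0 i2) * (e ^+ 2 - t ^+ 2)) / 2.
  by rewrite Eet et c1E mulr1; move: xy; rewrite /x /y; lra.
have -> : c2 ^+ 2 * ((L - P) / 2) - s2 ^+ 2 * ((- Q - L) / 2) =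
    ((xi 0 i1 + xi 0 i2) * (e ^+ 2 + t ^+ 2)
     - (xi 0 i1 - xi 0 i2) * (e ^+ 2 - t ^+ 2)) / 2.
  by rewrite Eet et c2E mulr1; move: xy; rewrite /x /y; lra.
have -> : c1 * c2 * (z / 2) - s1 * s2 * (w / 2) = (xi 0 i1 - xi 0 i2) * e * t.
  by lra.
have -> : c1 ^+ 2 * ((Q - L) / 2) - s1 ^+ 2 * ((L + P) / 2) =
    ((xi 0 i3 + xi 0 i4) * (e' ^+ 2 + t' ^+ 2)
     + (xi 0 i3 - xi 0 i4) * (e' ^+ 2 - t' ^+ 2)) / 2.
  by rewrite Eet' et' c1E mulr1; move: xy; rewrite /x /y; lra.
have -> : c2 ^+ 2 * ((- Q - L) / 2) - s2 ^+ 2 * ((L - P) / 2) =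
    ((xi 0 i3 + xi 0 i4) * (e' ^+ 2 + t' ^+ 2)
     - (xi 0 i3 - xi 0 i4) * (e' ^+ 2 - t' ^+ 2)) / 2.
  by rewrite Eet' et' c2E mulr1; move: xy; rewrite /x /y; lra.
have -> : c1 * c2 * (w / 2) - s1 * s2 * (z / 2) = (xi 0 i3 - xi 0 i4) * e' * t'.
  by lra.
have iP (k : 'I_4) : k \in [:: i1; i2; i3; i4].
  by case: k => [[|[|[|[|//]]]] ?]; rewrite !inE.
move: (iP i) (iP j) sij; rewrite !inE => /or4P[] /eqP -> /or4P[] /eqP -> //= _;
  rewrite !mxE /= !(opprK, mulNr, mulrN).
- transitivity (((xi 0 i1 + xi 0 i2) * (e ^+ 2 + t ^+ 2) ^+ 2
     + (xi 0 i1 - xi 0 i2) * (e ^+ 2 + t ^+ 2) ^+ 2) / 2); first by field.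
  by rewrite et; field.
- by field.
- by field.
- transitivity (((xi 0 i1 + xi 0 i2) * (e ^+ 2 + t ^+ 2) ^+ 2
     - (xi 0 i1 - xi 0 i2) * (e ^+ 2 + t ^+ 2) ^+ 2) / 2); first by field.
  by rewrite et; field.
- transitivity (((xi 0 i3 + xi 0 i4) * (e' ^+ 2 + t' ^+ 2) ^+ 2
     + (xi 0 i3 - xi 0 i4) * (e' ^+ 2 + t' ^+ 2) ^+ 2) / 2); first by field.
  by rewrite et'; field.
- by field.
- by field.
- transitivity (((xi 0 i3 + xi 0 i4) * (e' ^+ 2 + t' ^+ 2) ^+ 2
     - (xi 0 i3 - xi 0 i4) * (e' ^+ 2 + t' ^+ 2) ^+ 2) / 2); first by field.
  by rewrite et'; field.
Qed.

End Construction.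

(** * A saddle-point form of the intermediate value theorem *)

From mathcomp Require Import boolp functions topology normedtype realfun.
Import numFieldNormedType.Exports.

Section Analysis.
Variable R : realType.
Implicit Types (f g : R -> R) (x : R).

Definition cts f x := {for x, continuous f}.

Lemma cts_cst (k : R) x : cts (fun=> k) x.
Proof. exact: cst_continuous. Qed.
Lemma cts_id x : cts (fun t => t) x.
Proof. by move=> ?; exact. Qed.
Lemma ctsD f g x : cts f x -> cts g x -> cts (fun t => f t + g t) x.
Proof. exact: continuousD. Qed.
Lemma ctsN f x : cts f x -> cts (fun t => - f t) x.
Proof. exact: continuousN. Qed.
Lemma ctsM f g x : cts f x -> cts g x -> cts (fun t => f t * g t) x.
Proof. exact: continuousM. Qed.
Lemma ctsX f n x : cts f x -> cts (fun t => f t ^+ n) x.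
Proof.
move=> fx; elim: n => [|n IH]; first exact: cts_cst.
rewrite (_ : (fun t => f t ^+ n.+1) = (fun t => f t * f t ^+ n)); first exact: ctsM.
by apply/funext => t; rewrite exprS.
Qed.
Lemma ctsV f x : f x != 0 -> cts f x -> cts (fun t => (f t)^-1) x.
Proof. by move=> f0 fx; apply: continuousV. Qed.
Lemma cts_sqrt f x : cts f x -> cts (fun t => Num.sqrt (f t)) x.
Proof. by move=> fx; apply: continuous_comp => //; exact: sqrt_continuous. Qed.

Lemma ivt_zero f (x0 x1 : R) : x0 <= x1 -> (forall x, x0 <= x <= x1 -> cts f x) ->
  f x0 <= 0 -> 0 <= f x1 -> exists2 x, x0 <= x <= x1 & f x = 0.
Proof.
move=> x01 fc f0 f1.
have [||c cx fc0] := @IVT R f x0 x1 0 x01.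
- by apply: continuous_in_subspaceT => x; rewrite inE /= in_itv /=; exact: fc.
- by rewrite ge_min f0 le_max f1 orbT.
by exists c => //; move: cx; rewrite in_itv.
Qed.

Lemma quadratic_right_root (k b g x0 x1 : R) :
  0 < k -> x0 <= x1 -> (x0 = x1 -> b <= k * x1) -> 0 <= - k * x0 ^+ 2 + 2 * b * x0 + g ->
  - k * x1 ^+ 2 + 2 * b * x1 + g <= 0 ->
  let r := (b + Num.sqrt (b ^+ 2 + k * g)) / k in
  - k * r ^+ 2 + 2 * b * r + g = 0 /\ x0 <= r <= x1.
Proof.
move=> k0 x01 x01b h0 h1; set d := b ^+ 2 + k * g => r.
have d0 : 0 <= d.
  have -> : d = (k * x0 - b) ^+ 2 + k * (- k * x0 ^+ 2 + 2 * b * x0 + g).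
    by rewrite /d; ring.
  by rewrite addr_ge0 ?sqr_ge0 // mulr_ge0 // ltW.
have sd : Num.sqrt d ^+ 2 = d by rewrite sqr_sqrtr.
have s0 : 0 <= Num.sqrt d by exact: sqrtr_ge0.
have rk : k * r = b + Num.sqrt d by rewrite /r mulrC divfK // gt_eqF.
split.
  apply: (mulfI (lt0r_neq0 k0)); rewrite mulr0.
  have -> : k * (- k * r ^+ 2 + 2 * b * r + g) = b ^+ 2 + k * g - (k * r - b) ^+ 2.
    by ring.
  by rewrite rk [b + _]addrC addrK sd subrr.
rewrite -(ler_pM2l k0) -[_ <= x1](ler_pM2l k0) rk.
have e0 : (k * x0 - b) ^+ 2 <= Num.sqrt d ^+ 2.
  rewrite sd -subr_ge0.
  have -> : d - (k * x0 - b) ^+ 2 = k * (- k * x0 ^+ 2 + 2 * b * x0 + g).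
    by rewrite /d; ring.
  by rewrite mulr_ge0 // ltW.
have e1 : Num.sqrt d ^+ 2 <= (k * x1 - b) ^+ 2.
  rewrite sd -subr_le0.
  have -> : d - (k * x1 - b) ^+ 2 = k * (- k * x1 ^+ 2 + 2 * b * x1 + g).
    by rewrite /d; ring.
  by rewrite pmulr_rle0.
have lt01 : x0 != x1 -> k * x0 < k * x1.
  by move=> x01n; rewrite ltr_pM2l // lt_neqAle x01n.
move: (Num.sqrt d) (k * x0) (k * x1) s0 e0 e1 lt01 x01b => t y0 y1 t0 e0 e1 lt01 x01b.
apply/andP; split; first by rewrite leNgt; apply/negP => h; nra.
rewrite leNgt; apply/negP => h; have [x01e|/lt01 y01] := eqVneq x0 x1.
  by have := x01b x01e; nra.
have [y1b|y1b] := leP b y1; first by nra.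
by nra.
Qed.

(* E is convex in P and concave in m, so that either its zero set contains a
   curve m = m(P) joining the two upper corners of the rectangle, or a curve
   P = P(m) joining its two right corners. *)
Lemma saddle_zero (A c r q s : R) (F : R -> R -> R) :
  0 <= A -> 0 <= c -> 0 <= r -> A + c < q -> c + r < s ->
  (forall f g x, cts f x -> cts g x -> cts (fun t => F (f t) (g t)) x) ->
  let E (P m : R) := (q ^+ 2 - (P - c) ^+ 2) * (r ^+ 2 - (m - c) ^+ 2)
    - (A ^+ 2 - P ^+ 2) * (s ^+ 2 - m ^+ 2) in
  0 <= F A (c + r) -> F A (c - r) <= 0 -> F (- A) (c + r) <= 0 ->
  exists P m : R, [/\ - A <= P <= A, c - r <= m <= c + r, E P m = 0 & F P m = 0].
Proof.
move=> A0 c0 r0 qAc scr Fcts E F11 F10 F01.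
have Kp (P : R) : - A <= P <= A -> 0 < q ^+ 2 - (P - c) ^+ 2.
  by move=> /andP[? ?]; rewrite subr_sqr mulr_gt0 //; lra.
have Gp (P : R) : - A <= P <= A -> 0 <= A ^+ 2 - P ^+ 2.
  by move=> /andP[? ?]; rewrite subr_sqr mulr_ge0 //; lra.
have Hp (m : R) : c - r <= m <= c + r -> 0 <= r ^+ 2 - (m - c) ^+ 2.
  by move=> /andP[? ?]; rewrite subr_sqr mulr_ge0 //; lra.
have Sp (m : R) : c - r <= m <= c + r -> 0 < s ^+ 2 - m ^+ 2.
  by move=> /andP[? ?]; rewrite subr_sqr mulr_gt0 //; lra.
(* [kp] expresses concavity of [E] in m, and [lp] below convexity in P. *)
have kp (P : R) : - A <= P <= A -> 0 < q ^+ 2 - (P - c) ^+ 2 - (A ^+ 2 - P ^+ 2).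
  move=> /andP[? ?].
  have -> : q ^+ 2 - (P - c) ^+ 2 - (A ^+ 2 - P ^+ 2) =
    (q ^+ 2 - (A + c) ^+ 2) + 2 * (c * (P + A)) by ring.
  rewrite subr_sqr ltr_pwDl ?mulr_gt0 ?mulr_ge0 //; lra.
have lp (m : R) : c - r <= m <= c + r ->
    0 < s ^+ 2 - m ^+ 2 - (r ^+ 2 - (m - c) ^+ 2).
  move=> /andP[? ?].
  have -> : s ^+ 2 - m ^+ 2 - (r ^+ 2 - (m - c) ^+ 2) =
    (s ^+ 2 - (c + r) ^+ 2) + 2 * (c * (c + r - m)) by ring.
  rewrite subr_sqr ltr_pwDl ?mulr_gt0 ?mulr_ge0 //; lra.
have AA : - A <= A <= A by apply/andP; split; lra.
(* If every P admits some m with [E P m] nonnegative, the larger root in m is followed as P varies.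
   Otherwise [E P1] is negative for all m, and for each m the larger root in P, between [P1] and A,
   is followed. *)
have [h|/existsNP[P1 /not_implyP[P1A /forallNP h]]] :=
    pselect (forall P : R, - A <= P <= A -> exists m : R, c - r <= m <= c + r /\ 0 <= E P m).
  pose K P := q ^+ 2 - (P - c) ^+ 2; pose k P := K P - (A ^+ 2 - P ^+ 2).
  pose g P := K P * (r ^+ 2 - c ^+ 2) - (A ^+ 2 - P ^+ 2) * s ^+ 2.
  pose root P := (K P * c + Num.sqrt ((K P * c) ^+ 2 + k P * g P)) / k P.
  have EE P m : E P m = - k P * m ^+ 2 + 2 * (K P * c) * m + g P.
    by rewrite /E /k /g -/(K P); ring.
  have rootP (P : R) : - A <= P <= A -> E P (root P) = 0 /\ c - r <= root P <= c + r.
    move=> PA; have [m [/andP[m0 m1] Em]] := h _ PA.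
    have E1 : E P (c + r) = - ((A ^+ 2 - P ^+ 2) * (s ^+ 2 - (c + r) ^+ 2)).
      by rewrite /E; ring.
    have Sc : 0 < s ^+ 2 - (c + r) ^+ 2 by apply: Sp; apply/andP; split; lra.
    have [|||] := @quadratic_right_root (k P) (K P * c) (g P) m (c + r) (kp _ PA) m1.
    (* If m is already the endpoint c + r, nonnegativity of [E] there forces P^2 = A^2; the vertex
       of the parabola is then c, to the left of c + r. *)
    - move=> me; move: Em; rewrite me E1 oppr_ge0 pmulr_lle0 // => G0.
      have -> : k P = K P by rewrite /k; move: (Gp _ PA) G0; lra.
      by rewrite ler_pM2l ?Kp //; lra.
    - by rewrite -EE.
    - by rewrite -EE E1 oppr_le0 mulr_ge0 ?Gp // ltW.
    rewrite -/(root P) -EE => e /andP[u v].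
    by split=> //; apply/andP; split=> //; exact: le_trans u.
  (* The curve ends at the two upper corners, where the signs of [F] are given. *)
  have rootA (P : R) : - A <= P <= A -> A ^+ 2 - P ^+ 2 = 0 -> root P = c + r.
    move=> PA G0; have K0 := Kp _ PA; rewrite -/(K P) in K0.
    have kK : k P = K P by rewrite /k G0 subr0.
    rewrite /root /g G0 mul0r subr0 kK.
    have -> : (K P * c) ^+ 2 + K P * (K P * (r ^+ 2 - c ^+ 2)) = (K P * r) ^+ 2 by ring.
    rewrite sqrtr_sqr ger0_norm ?mulr_ge0 // ?ltW // -mulrDr mulrC mulKf //.
    by rewrite gt_eqF.
  have NAA : - A <= - A <= A by apply/andP; split; lra.
  have [||||P PA FP] := @ivt_zero (fun P => F P (root P)) (- A) A.
  - by lra.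
  - move=> P PA; apply: Fcts; first exact: cts_id.
    have cK : cts K P.
      by apply: ctsD; [exact: cts_cst | apply/ctsN/ctsX/ctsD; [exact: cts_id | exact: cts_cst]].
    have cG : cts (fun P => A ^+ 2 - P ^+ 2) P.
      by apply: ctsD; [exact: cts_cst | apply/ctsN/ctsX; exact: cts_id].
    have ck : cts k P by apply: ctsD => //; exact: ctsN.
    have cg : cts g P.
      by apply: ctsD; [apply: ctsM | apply/ctsN/ctsM] => //; exact: cts_cst.
    have cKc : cts (fun P => K P * c) P by apply: ctsM => //; exact: cts_cst.
    apply: ctsM; last by apply: ctsV => //; rewrite gt_eqF // kp.
    by apply: ctsD => //; apply/cts_sqrt/ctsD; [exact: ctsX | exact: ctsM].
  - by rewrite rootA // ?sqrrN ?subrr.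
  - by rewrite rootA // ?sqrrN ?subrr.
  by have [e m01] := rootP _ PA; exists P, (root P).
have En (m : R) : c - r <= m <= c + r -> E P1 m < 0.
  by move=> m01; rewrite ltNge; apply/negP => e; apply: (h m).
pose H m := r ^+ 2 - (m - c) ^+ 2; pose k m := s ^+ 2 - m ^+ 2 - H m.
pose g m := A ^+ 2 * (s ^+ 2 - m ^+ 2) - (q ^+ 2 - c ^+ 2) * H m.
pose root m := (- (c * H m) + Num.sqrt ((- (c * H m)) ^+ 2 + k m * g m)) / k m.
have EE P m : - E P m = - k m * P ^+ 2 + 2 * (- (c * H m)) * P + g m.
  by rewrite /E /k /g -/(H m); ring.
have rootP (m : R) : c - r <= m <= c + r -> E (root m) m = 0 /\ - A <= root m <= A.
  move=> m01; have [P1a P1b] := andP P1A.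
  have [|||] := @quadratic_right_root (k m) (- (c * H m)) (g m) P1 A (lp _ m01) P1b.
  - move=> P1e; have := En _ m01; rewrite P1e /E subrr mul0r subr0.
    by rewrite ltNge mulr_ge0 ?Hp // ltW // Kp.
  - by rewrite -EE oppr_ge0 ltW // En.
  - by rewrite -EE oppr_le0 /E subrr mul0r subr0 mulr_ge0 ?Hp // ltW // Kp.
  rewrite -/(root m) -EE => /eqP; rewrite oppr_eq0 => /eqP e /andP[u v].
  by split=> //; apply/andP; split=> //; exact: le_trans u.
(* The curve ends at the two right corners. *)
have rootr (m : R) : c - r <= m <= c + r -> H m = 0 -> root m = A.
  move=> m01 H0; have S0 := Sp _ m01.
  rewrite /root /g /k H0 !mulr0 !subr0 oppr0 add0r expr0n add0r /=.
  have -> : (s ^+ 2 - m ^+ 2) * (A ^+ 2 * (s ^+ 2 - m ^+ 2)) =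
    (A * (s ^+ 2 - m ^+ 2)) ^+ 2 by ring.
  by rewrite sqrtr_sqr ger0_norm ?mulr_ge0 // ?ltW // mulfK // gt_eqF.
have m0 : c - r <= c - r <= c + r by apply/andP; split; lra.
have m1 : c - r <= c + r <= c + r by apply/andP; split; lra.
have [||||m m01 Fm] := @ivt_zero (fun m => F (root m) m) (c - r) (c + r).
- by lra.
- move=> m m01; apply: Fcts; last exact: cts_id.
  have cH : cts H m.
    by apply: ctsD; [exact: cts_cst | apply/ctsN/ctsX/ctsD; [exact: cts_id | exact: cts_cst]].
  have cS : cts (fun m => s ^+ 2 - m ^+ 2) m.
    by apply: ctsD; [exact: cts_cst | apply/ctsN/ctsX; exact: cts_id].
  have ck : cts k m by apply: ctsD => //; exact: ctsN.
  have cg : cts g m.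
    by apply: ctsD; [|apply: ctsN]; apply: ctsM => //; exact: cts_cst.
  have ccH : cts (fun m => - (c * H m)) m by apply/ctsN/ctsM => //; exact: cts_cst.
  apply: ctsM; last by apply: ctsV => //; rewrite gt_eqF // lp.
  by apply: ctsD => //; apply/cts_sqrt/ctsD; [exact: ctsX | exact: ctsM].
- by rewrite rootr // /H; ring.
- by rewrite rootr // /H; ring.
by have [e PA] := rootP _ m01; exists (root m), m.
Qed.

End Analysis.

(** * Existence of Cartan parameters *)

Section Params.
Variable R : realType.

(** The equations of [block_reachable_params] in the gaps, with L = Lam_1 + Lam_2 and s the growth
    of the trace of the first block. *)
Definition cartan_params (A B a b L s : R) : Prop :=
  exists P Q z w c1 s1 c2 s2 : R,
  let x := s1 ^+ 2 * (2 * L + P - Q) in let y := s2 ^+ 2 * (2 * L - P + Q) in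
  [/\ P ^+ 2 + z ^+ 2 = A ^+ 2, Q ^+ 2 + w ^+ 2 = B ^+ 2,
    c1 ^+ 2 - s1 ^+ 2 = 1 & c2 ^+ 2 - s2 ^+ 2 = 1] /\
  [/\ x + y = 2 * s,
    (P + (x - y) / 2) ^+ 2 + (c1 * c2 * z - s1 * s2 * w) ^+ 2 = a ^+ 2
  & (Q - (x - y) / 2) ^+ 2 + (c1 * c2 * w - s1 * s2 * z) ^+ 2 = b ^+ 2].

(** Exchange of the two blocks: (P, Q) becomes (-Q, -P), which preserves P - Q and hence x and y. *)
Lemma cartan_params_swap A B a b L s :
  cartan_params B A b a L s -> cartan_params A B a b L s.
Proof.
move=> [P [Q [z [w [c1 [s1 [c2 [s2 [[e1 e2 e3 e4] [e5 e6 e7]]]]]]]]]].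
exists (- Q), (- P), w, z, c1, s1, c2, s2.
have -> : 2 * L - Q - - P = 2 * L + P - Q by ring.
have -> : 2 * L - - Q - P = 2 * L - P + Q by ring.
by split; split=> //; rewrite ?sqrrN // -?e6 -?e7; ring.
Qed.

(** Here m = (x - y)/2, so x = s + m and y = s - m determine the boosts, with all square roots
    nonnegative; C and S stand for c1 c2 and s1 s2. The equation for a is replaced by its difference
    with the one for b, where the cross terms cancel: (C z - S w)^2 - (C w - S z)^2 = (C^2 -
    S^2)(z^2 - w^2), and C^2 - S^2 = 1 + (s + m)/D1 + (s - m)/D2. *)
Lemma cartan_params_of (A B a b L s P Q m : R) :
  let D1 := 2 * L + P - Q in let D2 := 2 * L - P + Q in
  0 < D1 -> 0 < D2 -> - s <= m <= s -> - A <= P <= A -> - B <= Q <= B ->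
  let z := Num.sqrt (A ^+ 2 - P ^+ 2) in let w := Num.sqrt (B ^+ 2 - Q ^+ 2) in
  (forall C S : R, 0 < C -> 0 <= S ->
     C ^+ 2 = (1 + (s + m) / D1) * (1 + (s - m) / D2) ->
     S ^+ 2 = (s + m) / D1 * ((s - m) / D2) ->
     (Q - m) ^+ 2 + (C * w - S * z) ^+ 2 = b ^+ 2) ->
  D1 * D2 * ((P + m) ^+ 2 - (Q - m) ^+ 2 - (a ^+ 2 - b ^+ 2))
  + (D1 * D2 + 4 * L * s - 2 * m * (P - Q)) * (A ^+ 2 - P ^+ 2 - B ^+ 2 + Q ^+ 2) = 0 ->
  cartan_params A B a b L s.
Proof.
move=> D1 D2 D10 D20 /andP[m1 m2] /andP[P1 P2] /andP[Q1 Q2] z w hb hF.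
have z2 : z ^+ 2 = A ^+ 2 - P ^+ 2.
  by rewrite sqr_sqrtr // subr_sqr mulr_ge0 //; lra.
have w2 : w ^+ 2 = B ^+ 2 - Q ^+ 2.
  by rewrite sqr_sqrtr // subr_sqr mulr_ge0 //; lra.
pose al := (s + m) / D1; pose be := (s - m) / D2.
have al0 : 0 <= al by rewrite divr_ge0 ?(ltW D10) //; lra.
have be0 : 0 <= be by rewrite divr_ge0 ?(ltW D20) //; lra.
have al1 : 0 < 1 + al by lra.
have be1 : 0 < 1 + be by lra.
have sal : Num.sqrt al ^+ 2 = al by rewrite sqr_sqrtr.
have sbe : Num.sqrt be ^+ 2 = be by rewrite sqr_sqrtr.
have cal : Num.sqrt (1 + al) ^+ 2 = 1 + al by rewrite sqr_sqrtr // ltW.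
have cbe : Num.sqrt (1 + be) ^+ 2 = 1 + be by rewrite sqr_sqrtr // ltW.
have alD : al * D1 = s + m by rewrite divfK ?gt_eqF.
have beD : be * D2 = s - m by rewrite divfK ?gt_eqF.
exists P, Q, z, w, (Num.sqrt (1 + al)), (Num.sqrt al), (Num.sqrt (1 + be)), (Num.sqrt be).
move=> x y; rewrite {}/x {}/y -/D1 -/D2 sal sbe cal cbe alD beD.
have -> : (s + m - (s - m)) / 2 = m by field.
have Eb := hb (Num.sqrt (1 + al) * Num.sqrt (1 + be)) (Num.sqrt al * Num.sqrt be).
have {}Eb : (Q - m) ^+ 2 + (Num.sqrt (1 + al) * Num.sqrt (1 + be) * w
    - Num.sqrt al * Num.sqrt be * z) ^+ 2 = b ^+ 2.
  apply: Eb; rewrite ?mulr_gt0 ?sqrtr_gt0 ?mulr_ge0 ?sqrtr_ge0 //.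
    by rewrite exprMn cal cbe.
  by rewrite exprMn sal sbe.
split; split=> //; [by rewrite z2; ring | by rewrite w2; ring | by ring | by ring
  | by ring |].
have hF' : (P + m) ^+ 2 - (Q - m) ^+ 2 - (a ^+ 2 - b ^+ 2)
    + (1 + al + be) * (z ^+ 2 - w ^+ 2) = 0.
  rewrite z2 w2 -[RHS](mul0r (D1 * D2)^-1) -hF /al /be /D1 /D2; field.
  by rewrite -/D1 -/D2 !gt_eqF.
move: hF' Eb cal cbe sal sbe.
move: (Num.sqrt (1 + al)) (Num.sqrt (1 + be)) (Num.sqrt al) (Num.sqrt be).
move=> c1 c2 s1 s2 hF' Eb cal cbe sal sbe.
have K : (c1 * c2 * z - s1 * s2 * w) ^+ 2 - (c1 * c2 * w - s1 * s2 * z) ^+ 2 =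
    (1 + al + be) * (z ^+ 2 - w ^+ 2).
  transitivity ((c1 ^+ 2 * c2 ^+ 2 - s1 ^+ 2 * s2 ^+ 2) * (z ^+ 2 - w ^+ 2)).
    by ring.
  by rewrite cal cbe sal sbe; ring.
by move: hF' Eb; rewrite -K; move: (b ^+ 2) => b2; lra.
Qed.


Lemma ler_sqr_bounds (u v : R) : - v <= u -> u <= v -> u ^+ 2 <= v ^+ 2.
Proof. by move=> h1 h2; rewrite -subr_ge0 subr_sqr mulr_ge0 //; lra. Qed.

(* Here the noncompact part of g is a single boost. *)
Lemma cartan_params_rank1 (A B a b L s : R) :
  0 <= A -> 0 <= B -> 0 <= a -> 0 <= b -> 0 <= s -> A + B < 2 * L ->
  A - s <= a -> s - A <= a -> a <= A + s -> B - s <= b -> s - B <= b -> b <= B + s ->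
  cartan_params A B a b L s.
Proof.
move=> A0 B0 a0 b0 s0 AB a1 a2 a3 b1 b2 b3.
have [s1|s1] := eqVneq s 0.
  rewrite s1 in a1 a3 b1 b3; rewrite s1; exists A, B, 0, 0, 1, 0, 1, 0 => x y.
  have -> : a = A by lra.
  have -> : b = B by lra.
  by rewrite /x /y; split; split; ring.
have sp : 0 < s by rewrite lt0r s1.
(* With m = s the second boost is trivial, and the equations for a and b read u = P + (A^2 - P^2)/D1
   and v = - Q + (B^2 - Q^2)/D1, where D1 = 2L + P - Q. *)
pose u := (a ^+ 2 - A ^+ 2 - s ^+ 2) / (2 * s).
pose v := (b ^+ 2 - B ^+ 2 - s ^+ 2) / (2 * s).
have uE : 2 * s * u = a ^+ 2 - A ^+ 2 - s ^+ 2 by rewrite /u; field.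
have vE : 2 * s * v = b ^+ 2 - B ^+ 2 - s ^+ 2 by rewrite /v; field.
have bound (X y e : R) : X - s <= e -> s - X <= e -> e <= X + s -> 0 <= X -> 0 <= e ->
    2 * s * y = e ^+ 2 - X ^+ 2 - s ^+ 2 -> - X <= y <= X.
  move=> h1 h2 h3 X0 e0 yE; apply/andP; split; rewrite -(ler_pM2l (_ : 0 < 2 * s)) ?yE; try lra.
    have : (X - s) ^+ 2 <= e ^+ 2 by apply: ler_sqr_bounds; lra.
    by lra.
  have : e ^+ 2 <= (X + s) ^+ 2 by apply: ler_sqr_bounds; lra.
  by lra.
have /andP[u1 u2] := bound _ _ _ a1 a2 a3 A0 a0 uE.
have /andP[v1 v2] := bound _ _ _ b1 b2 b3 B0 b0 vE.
(* The equation for u is linear in P, with solution [p Q]; [h] is the equation for v after this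
   substitution. *)
pose p Q := (u * (2 * L - Q) - A ^+ 2) / (2 * L - Q - u).
pose h Q := Q * (2 * L + p Q - v) - B ^+ 2 + v * (2 * L + p Q).
have Dp (Q : R) : - B <= Q <= B -> 0 < 2 * L - Q - u by move=> /andP[? ?]; lra.
have pE (Q : R) : - B <= Q <= B -> p Q * (2 * L - Q - u) = u * (2 * L - Q) - A ^+ 2.
  by move=> QB; rewrite divfK // gt_eqF // Dp.
have pA (Q : R) : - B <= Q <= B -> - A <= p Q <= A.
  move=> QB; have D0 := Dp _ QB; have [q1 q2] := andP QB.
  apply/andP; split; rewrite -(ler_pM2r D0) pE // -subr_ge0.
    rewrite [X in 0 <= X](_ : _ = (u + A) * (2 * L - Q - A)); last by ring.
    by rewrite mulr_ge0 //; lra.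
  rewrite [X in 0 <= X](_ : _ = (A - u) * (2 * L - Q + A)); last by ring.
  by rewrite mulr_ge0 //; lra.
have BB : - B <= B <= B by apply/andP; split; lra.
have NBB : - B <= - B <= B by apply/andP; split; lra.
have [||||Q QB hQ] := @ivt_zero _ h (- B) B.
- by lra.
- move=> Q QB.
  have c2 : cts (fun Q => 2 * L - Q) Q.
    by apply: ctsD; [exact: cts_cst | apply: ctsN; exact: cts_id].
  have cp : cts p Q.
    apply: ctsM.
      by apply: ctsD; [apply: ctsM => //; exact: cts_cst | exact: cts_cst].
    by apply: ctsV; [rewrite gt_eqF // Dp | apply: ctsD => //; exact: cts_cst].
  have cLp : cts (fun Q => 2 * L + p Q) Q by apply: ctsD => //; exact: cts_cst.
  apply: ctsD; last by apply: ctsM => //; exact: cts_cst.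
  apply: ctsD; last exact: cts_cst.
  by apply: ctsM; [exact: cts_id | apply: ctsD => //; exact: cts_cst].
- have /andP[? ?] := pA _ NBB; rewrite /h.
  rewrite [X in X <= 0](_ : _ = - ((B - v) * (2 * L + p (- B) + B))); last by ring.
  by rewrite oppr_le0 mulr_ge0 //; lra.
- have /andP[? ?] := pA _ BB; rewrite /h.
  rewrite [X in 0 <= X](_ : _ = (B + v) * (2 * L + p B - B)); last by ring.
  by rewrite mulr_ge0 //; lra.
have := pE _ QB; have PA := pA _ QB; move: hQ; rewrite /h.
move: (p Q) PA => P PA hQ hP; have [? ?] := andP PA; have [? ?] := andP QB.
have D0 : 0 < 2 * L + P - Q by lra.
apply: (@cartan_params_of A B a b L s P Q s) => //; try lra.
- move=> C S C0 S0; rewrite subrr mul0r addr0 mulr1 mulr0 => C2 /eqP.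
  rewrite sqrf_eq0 => /eqP ->; rewrite mul0r subr0 exprMn C2 sqr_sqrtr; last first.
    by rewrite subr_sqr mulr_ge0 //; lra.
  have B2 : B ^+ 2 - Q ^+ 2 = (v + Q) * (2 * L + P - Q) by lra.
  rewrite B2; transitivity (2 * s * v + B ^+ 2 + s ^+ 2); last by rewrite vE; ring.
  transitivity ((Q - s) ^+ 2 + (2 * L + P - Q + 2 * s) * (v + Q)).
    by field; rewrite gt_eqF.
  by move: B2; lra.
have a2E : a ^+ 2 = 2 * s * u + A ^+ 2 + s ^+ 2 by rewrite uE; ring.
have b2E : b ^+ 2 = 2 * s * v + B ^+ 2 + s ^+ 2 by rewrite vE; ring.
have A2 : A ^+ 2 = P ^+ 2 + (u - P) * (2 * L + P - Q) by lra.
have B2 : B ^+ 2 = Q ^+ 2 + (v + Q) * (2 * L + P - Q) by lra.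
by rewrite a2E b2E A2 B2; ring.
Qed.

Ltac continuity := repeat lazymatch goal with
  | |- cts (fun=> ?k) _ => exact: cts_cst
  | |- cts (fun t => @?f t + @?g t) _ => apply: ctsD
  | |- cts (fun t => - @?f t) _ => apply: ctsN
  | |- cts (fun t => @?f t * @?g t) _ => apply: ctsM
  | |- cts (fun t => @?f t ^+ _) _ => apply: ctsX
  | _ => assumption
  end.

(* Here the second block of k.Lam is diagonal: Q = B and w = 0. *)
Lemma cartan_params_above (A B a b L s : R) :
  0 <= A -> 0 <= B -> 0 <= a -> 0 <= b -> A + B < 2 * L ->
  B + b < s -> B + b <= A + a -> A - B <= a + b -> A + B <= a + b ->
  b - a <= A + B -> a - b <= A + B ->
  cartan_params A B a b L s.
Proof.
move=> A0 B0 a0 b0 AB sBb h1 h2 h3 h4 h5.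
pose F (P m : R) := (2 * L + P - B) * (2 * L - P + B)
   * ((P + m) ^+ 2 - (B - m) ^+ 2 - (a ^+ 2 - b ^+ 2))
  + ((2 * L + P - B) * (2 * L - P + B) + 4 * L * s - 2 * m * (P - B)) * (A ^+ 2 - P ^+ 2).
(* With w = 0 and S^2 = (s^2 - m^2)/(D1 D2), the equation for b times D1 D2 is [E P m = 0] for c =
   B, r = b, q = 2L. [F] is the difference equation of [cartan_params_of] at Q = B. *)
have [||||P [m [PA mB E0 F0]]] := @saddle_zero _ A B b (2 * L) s F A0 B0 b0 AB sBb.
- by move=> f g x fx gx; rewrite /F; continuity.
- rewrite /F [X in 0 <= X](_ : _ = (2 * L + A - B) * (2 * L - A + B)
    * ((A + B + b) ^+ 2 - a ^+ 2)); last by ring.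
  have : a ^+ 2 <= (A + B + b) ^+ 2 by apply: ler_sqr_bounds; lra.
  by move=> ?; rewrite !mulr_ge0 //; lra.
- rewrite /F [X in X <= 0](_ : _ = - ((2 * L + A - B) * (2 * L - A + B)
    * (a ^+ 2 - (A + B - b) ^+ 2))); last by ring.
  have : (A + B - b) ^+ 2 <= a ^+ 2 by apply: ler_sqr_bounds; lra.
  by move=> ?; rewrite oppr_le0 !mulr_ge0 //; lra.
- rewrite /F [X in X <= 0](_ : _ = - ((2 * L - A - B) * (2 * L + A + B)
    * (a ^+ 2 - (B + b - A) ^+ 2))); last by ring.
  have : (B + b - A) ^+ 2 <= a ^+ 2 by apply: ler_sqr_bounds; lra.
  by move=> ?; rewrite oppr_le0 !mulr_ge0 //; lra.
have [? ?] := andP PA; have [? ?] := andP mB.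
have D10 : 0 < 2 * L + P - B by lra.
have D20 : 0 < 2 * L - P + B by lra.
apply: (@cartan_params_of A B a b L s P B m) => //; try lra.
- move=> C S C0 S0 _ S2; rewrite subrr sqrtr0 mulr0 sub0r sqrrN exprMn S2 sqr_sqrtr.
  have -> : b ^+ 2 = (m - B) ^+ 2 + (A ^+ 2 - P ^+ 2) * (s ^+ 2 - m ^+ 2)
      / ((2 * L + P - B) * (2 * L - P + B)).
    have <- : (2 * L + P - B) * (2 * L - P + B) * (b ^+ 2 - (m - B) ^+ 2) =
        (A ^+ 2 - P ^+ 2) * (s ^+ 2 - m ^+ 2) by lra.
    by field; rewrite !gt_eqF.
  by field; rewrite !gt_eqF.
- by rewrite subr_sqr mulr_ge0 //; lra.
by rewrite -[RHS]F0 /F; ring.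
Qed.

(* Here the second block of the projection of g.Lam is diagonal, with trace
   free part (Q - m, 0) = (b, 0). *)
Lemma cartan_params_below (A B a b L s : R) :
  0 <= A -> 0 <= B -> 0 <= a -> 0 <= b -> A + B < 2 * L ->
  B + b < s -> B + b <= A + a -> A - B <= a + b -> a + b <= A + B ->
  cartan_params A B a b L s.
Proof.
move=> A0 B0 a0 b0 AB sBb h1 h2 h3.
pose F (P m : R) := - ((2 * L + P - (b - m)) * (2 * L - P + (b - m))
   * ((P - m) ^+ 2 - b ^+ 2 - (a ^+ 2 - b ^+ 2))
  + ((2 * L + P - (b - m)) * (2 * L - P + (b - m)) + 4 * L * s + 2 * m * (P - (b - m)))
    * (A ^+ 2 - P ^+ 2 - B ^+ 2 + (b - m) ^+ 2)).
have Ab : A + b < 2 * L + s by lra.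
have sbB : b + B < s by lra.
(* With Q = b - m and -m in the role of m in [cartan_params_of], the equation for b follows from C w
   = S z. Squared and cleared of denominators, this is [E P m = 0] for c = b, r = B, q = 2L + s. [F]
   is negated to fit the corner signs. *)
have [||||P [m [PA mB E0 F0]]] := @saddle_zero _ A b B (2 * L + s) s F A0 b0 B0 Ab sbB.
- by move=> f g x fx gx; rewrite /F; continuity.
- rewrite /F [X in 0 <= X](_ : _ = (2 * L + A + B) * (2 * L - A - B)
    * (a ^+ 2 - (b + B - A) ^+ 2)); last by ring.
  have : (b + B - A) ^+ 2 <= a ^+ 2 by apply: ler_sqr_bounds; lra.
  by move=> ?; rewrite !mulr_ge0 //; lra.
- rewrite /F [X in X <= 0](_ : _ = - ((2 * L + A - B) * (2 * L - A + B)
    * ((A + B - b) ^+ 2 - a ^+ 2))); last by ring.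
  have : a ^+ 2 <= (A + B - b) ^+ 2 by apply: ler_sqr_bounds; lra.
  by move=> ?; rewrite oppr_le0 !mulr_ge0 //; lra.
- rewrite /F [X in X <= 0](_ : _ = - ((2 * L - A + B) * (2 * L + A - B)
    * ((A + b + B) ^+ 2 - a ^+ 2))); last by ring.
  have : a ^+ 2 <= (A + b + B) ^+ 2 by apply: ler_sqr_bounds; lra.
  by move=> ?; rewrite oppr_le0 !mulr_ge0 //; lra.
have [? ?] := andP PA; have [? ?] := andP mB.
have D10 : 0 < 2 * L + P - (b - m) by lra.
have D20 : 0 < 2 * L - P + (b - m) by lra.
have G0 : 0 <= A ^+ 2 - P ^+ 2 by rewrite subr_sqr mulr_ge0 //; lra.
have H0 : 0 <= B ^+ 2 - (b - m) ^+ 2 by rewrite subr_sqr mulr_ge0 //; lra.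
apply: (@cartan_params_of A B a b L s P (b - m) (- m)) => //; try lra; last first.
  by move/eqP: F0; rewrite oppr_eq0 => /eqP F0; rewrite -[RHS]F0; ring.
move=> C S C0 S0 C2 S2.
suff -> : C * Num.sqrt (B ^+ 2 - (b - m) ^+ 2) = S * Num.sqrt (A ^+ 2 - P ^+ 2).
  by rewrite subrr; ring.
apply/eqP; rewrite -(@eqrXn2 _ 2) ?mulr_ge0 ?sqrtr_ge0 ?(ltW C0) //.
rewrite !exprMn !sqr_sqrtr // C2 S2; apply/eqP.
have K0 : 0 < (2 * L + s) ^+ 2 - (P - b) ^+ 2 by rewrite subr_sqr mulr_gt0 //; lra.
have -> : B ^+ 2 - (b - m) ^+ 2 = (A ^+ 2 - P ^+ 2) * (s ^+ 2 - m ^+ 2)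
    / ((2 * L + s) ^+ 2 - (P - b) ^+ 2).
  have <- : ((2 * L + s) ^+ 2 - (P - b) ^+ 2) * (B ^+ 2 - (m - b) ^+ 2) =
      (A ^+ 2 - P ^+ 2) * (s ^+ 2 - m ^+ 2) by lra.
  by field; rewrite gt_eqF.
by field; rewrite !gt_eqF.
Qed.

(** In terms of Lam and xi, [A + B < 2 * L] is Lam_3 < Lam_2, the bounds by s are those on the
    single xi_i, and the last two hypotheses are the remaining inequalities. The swap of blocks
    allows B + b to be the smaller of A + a and B + b; the comparison of s with it selects the
    construction. *)
Lemma cartan_params_exist (A B a b L s : R) :
  0 <= A -> 0 <= B -> 0 <= a -> 0 <= b -> A + B < 2 * L ->
  `|A - a| <= s -> `|B - b| <= s -> `|a - b| <= A + B -> `|A - B| <= a + b ->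
  cartan_params A B a b L s.
Proof.
move=> A0 B0 a0 b0 AB; rewrite !ler_norml.
move=> /andP[? ?] /andP[? ?] /andP[? ?] /andP[? ?].
have large A' B' a' b' : 0 <= A' -> 0 <= B' -> 0 <= a' -> 0 <= b' -> A' + B' < 2 * L ->
    B' + b' < s -> B' + b' <= A' + a' -> A' - B' <= a' + b' -> a' - b' <= A' + B' ->
    b' - a' <= A' + B' -> cartan_params A' B' a' b' L s.
  move=> *; have [?|?] := leP (A' + B') (a' + b'); first exact: cartan_params_above.
  by apply: cartan_params_below => //; lra.
have [?|?] := leP (B + b) (A + a).
  have [?|?] := ltP (B + b) s; first by apply: large => //; lra.
  by apply: cartan_params_rank1 => //; lra.
apply: cartan_params_swap; have [?|?] := ltP (A + a) s; first by apply: large => //; lra.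
by apply: cartan_params_rank1 => //; lra.
Qed.

End Params.

(** * The moment polytope *)

Theorem theorem7p8 (R : realType) (Lam : 'rV[R]_4)
    (hLam : holomorphic_chamber Lam) :
  Delta_K (orbit_of (tstar Lam)) =
  [set tstar xi | xi in [set xi : 'rV[R]_4 | normalized xi /\
    [/\ [/\ xi 0 i1 >= Lam 0 i1, xi 0 i2 >= Lam 0 i2,
            xi 0 i3 <= Lam 0 i3 & xi 0 i4 <= Lam 0 i4],
        `|xi 0 i1 - xi 0 i2 - xi 0 i3 + xi 0 i4|
          <= Lam 0 i1 - Lam 0 i2 + Lam 0 i3 - Lam 0 i4,
        - xi 0 i1 + xi 0 i2 - xi 0 i3 + xi 0 i4
          <= - `|Lam 0 i1 - Lam 0 i2 - Lam 0 i3 + Lam 0 i4|,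
        xi 0 i1 >= xi 0 i2
      & xi 0 i3 >= xi 0 i4]]].
Proof.
have [nL oL12 oL23 oL34] := hLam; rewrite Delta_K_orbitE //.
have sL : Lam 0 i1 + Lam 0 i2 + Lam 0 i3 + Lam 0 i4 = 0 by rewrite -sum4.
apply/seteqP; split=> x [xi [nx]].
  move=> [ox12 ox34 [g sg hg]] <-; exists xi => //.
  have sx : xi 0 i1 + xi 0 i2 + xi 0 i3 + xi 0 i4 = 0 by rewrite -sum4.
  have [? ? ? ?] := eigenvalue_bounds sg hg hLam ox12 ox34.
  have [? ? ? ?] := eigenvalue_sum_bounds sg hg hLam ox12 ox34.
  (* As coordinates sum to zero, the alternating sums are 2(xi_1 + xi_4), -2(xi_1 + xi_3), 2(Lam_1 +
     Lam_3) and 2(Lam_1 + Lam_4), so the bounds on sums of pairs apply. *)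
  split=> //; split=> //; first by rewrite ler_norml; apply/andP; split; lra.
  by rewrite lerNr ler_norml; apply/andP; split; lra.
move=> [[? ? ? ?]].
rewrite lerNr !ler_norml => /andP[? ?] /andP[? ?] ox12 ox34 <-.
have sx : xi 0 i1 + xi 0 i2 + xi 0 i3 + xi 0 i4 = 0 by rewrite -sum4.
exists xi => //; split=> //; split=> //.
have : cartan_params (Lam 0 i1 - Lam 0 i2) (Lam 0 i3 - Lam 0 i4)
    (xi 0 i1 - xi 0 i2) (xi 0 i3 - xi 0 i4) (Lam 0 i1 + Lam 0 i2)
    (xi 0 i1 + xi 0 i2 - (Lam 0 i1 + Lam 0 i2)).
  by apply: cartan_params_exist; rewrite ?ler_norml; lra.
move=> [P [Q [z [w [c1 [s1 [c2 [s2 [[e1 e2 e3 e4] [e5 e6 e7]]]]]]]]]].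
exact: (block_reachable_params nL nx oL12 oL34 ox12 ox34 e1 e2 e3 e4 e5 e6 e7).
Qed.
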